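(* Let $q\in\mathbb C$ with $q\ne0$, $|q|\neq 1$, and let $r,s\in\mathbb Z$ with $r\neq-1$. Let $f_{q,\lambda}(t)\in\mathbb C[[t]]$ be an invertible formal power series, and for $1\le i<j<k\le6$ let $$\mathsf R^{(s)}_{ijk}(\lambda)= f_{q,\lambda}\bigl(\tilde w^{(s)}_{ijk}\bigr)\,\bigl\langle\lambda\,w^{(s)}_{ijk}\bigr\rangle_{q^{r+1}}\,\mathsf F_{ijk}=\mathsf F_{ijk}\,f_{q,\lambda}\bigl(w^{(s)}_{ijk}\bigr)\,\bigl\langle\lambda\,\tilde w^{(s)}_{ijk}\bigr\rangle_{q^{r+1}},$$ where $$w^{(s)}_{ijk}=a_i^{r-s}a_j^{s-r}\,b_ib_k^{-1}a_k^{s+1},\qquad \tilde w^{(s)}_{ijk}=a_k^{s-r}\,b_ib_k^{-1}a_i^{-s-1}a_j^{s+1}.$$ If $\mathsf R^{(s)}(\lambda)$ is an involution, i.e. $\bigl(\mathsf R^{(s)}(\lambda)\bigr)^2=1$, then $R=\mathsf R^{(s)}$ satisfies the tetrahedron equation $$R_{123} (\lambda) \, R_{145} (\lambda\mu) \, R_{246} (\nu) \, R_{356}(\mu) = R_{356}(\nu) \, R_{246}(\mu) \, R_{145}(\lambda\nu) \, R_{123}(\lambda).$$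
   Context: Here $\lambda,\mu,\nu\in\mathbb C$, and $\mathsf R^{(s)}(\lambda)$ stands for $\mathsf R^{(s)}_{ijk}(\lambda)$ with any fixed indices, e.g. $(i,j,k)=(1,2,3)$. $Q_q(6)$ is the associative unital $\mathbb C$-algebra with generators $a_i^{\pm1},b_i^{\pm1}$, $i=1,\dots,6$, and relations $a_ib_j=q^{\delta_{ij}}b_ja_i$, $a_ia_j=a_ja_i$, $b_ib_j=b_jb_i$, $a_ia_i^{-1}=a_i^{-1}a_i=1$, $b_ib_i^{-1}=b_i^{-1}b_i=1$. For $p\in\mathbb C$ nonzero with $|p|\ne1$, $\langle x\rangle_p=\sum_{n\ge 0}\frac{(-x)^n}{(1-p)(1-p^2)\cdots(1-p^n)}$ is a formal power series in $x$ (the $n=0$ term is $1$). For $1\le i<j<k\le 6$, $\mathcal F_{ijk}$ is the involutive automorphism of $Q_q(6)$ given by $a_i\mapsto a_i$, $a_j\mapsto a_ia_k$, $a_k\mapsto a_i^{-1}a_j$, $b_i\mapsto b_ib_jb_k^{-1}$, $b_j\mapsto b_k$, $b_k\mapsto b_j$, and fixing all $a_l,b_l$ with $l\notin\{i,j,k\}$. These satisfy $\mathcal F_{123}\mathcal F_{145}\mathcal F_{246}\mathcal F_{356}=\mathcal F_{356}\mathcal F_{246}\mathcal F_{145}\mathcal F_{123}$ (composition), and $\mathcal F_{ijk}$ interchanges $w^{(s)}_{ijk}$ and $\tilde w^{(s)}_{ijk}$, which commute and are algebraically independent. $\mathsf F_{ijk}$ is a formal element (generator of the outer automorphism $\mathcal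 F_{ijk}$) with $\mathsf F_{ijk}^2=1$ and $\mathsf F_{ijk}\,x=\mathcal F_{ijk}(x)\,\mathsf F_{ijk}$ for $x\in Q_q(6)$; the $\mathsf F$'s multiply as the automorphisms $\mathcal F_{ijk}$ do. The expressions are treated as formal power series in the non-commuting monomials, multiplied termwise.
   Formalization: The formal theorem also assumes that $f_{q,\lambda\mu}$ and $f_{q,\lambda\nu}$ have equal constant terms; the involution fixes $f_{q,\lambda}(0)$ only up to a sign that may vary with $\lambda$, and the equation fails when these two signs differ. *)

(* Defs.v *)
From HB Require Import structures.
From mathcomp Require Import all_boot all_order all_algebra.
From mathcomp Require Import all_classical reals complex ring.

Set Implicit Arguments.
Unset Strict Implicit.
Unset Printing Implicit Defensive.
Import Order.TTheory GRing.Theory Num.Theory.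
Local Open Scope ring_scope.

(* The algebra Q_q(6) has the C-basis of normally ordered monomials a^m b^n,
   m, n in Z^6.  The record (e, m, n) stands for q^e a^m b^n; these elements
   form a group, since b^n a^m = q^(- n.m) a^m b^n.  Scalars other than powers
   of q are carried by the coefficients of the formal expressions below. *)
Notation expo := {ffun 'I_6 -> int}.

Record mono : Type := Mono { qdeg : int; adeg : expo; bdeg : expo }.

Definition expo_dot (n m : expo) : int := \sum_(l < 6) n l * m l.

Definition mono_one : mono := Mono 0 0 0.
Definition mono_mul (x y : mono) : mono :=
  Mono (qdeg x + qdeg y - expo_dot (bdeg x) (adeg y))
       (adeg x + adeg y) (bdeg x + bdeg y).
Definition mono_inv (x : mono) : mono :=
  Mono (- qdeg x - expo_dot (bdeg x) (adeg x)) (- adeg x) (- bdeg x).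

Definition mono_code (x : mono) : int * expo * expo :=
  (qdeg x, adeg x, bdeg x).
Definition mono_decode (t : int * expo * expo) : mono := Mono t.1.1 t.1.2 t.2.
Lemma mono_codeK : cancel mono_code mono_decode.
Proof. by case. Qed.
HB.instance Definition _ := Choice.copy mono (can_type mono_codeK).

Lemma expo_dotDl n n' m : expo_dot (n + n') m = expo_dot n m + expo_dot n' m.
Proof. by rewrite -big_split; apply: eq_bigr => l _; rewrite ffunE mulrDl. Qed.

Lemma expo_dotDr n m m' : expo_dot n (m + m') = expo_dot n m + expo_dot n m'.
Proof. by rewrite -big_split; apply: eq_bigr => l _; rewrite ffunE mulrDr. Qed.

Lemma expo_dot0l m : expo_dot 0 m = 0.
Proof. by rewrite /expo_dot big1 // => l _; rewrite ffunE mul0r. Qed.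

Lemma expo_dot0r n : expo_dot n 0 = 0.
Proof. by rewrite /expo_dot big1 // => l _; rewrite ffunE mulr0. Qed.

Lemma expo_dotNl n m : expo_dot (- n) m = - expo_dot n m.
Proof. by apply/eqP; rewrite -addr_eq0 -expo_dotDl addNr expo_dot0l. Qed.

Lemma expo_dotNr n m : expo_dot n (- m) = - expo_dot n m.
Proof. by apply/eqP; rewrite -addr_eq0 -expo_dotDr addNr expo_dot0r. Qed.

Lemma mono_mulA : associative mono_mul.
Proof.
move=> x y z; rewrite /mono_mul /= expo_dotDl expo_dotDr !addrA.
by congr Mono; ring.
Qed.

Lemma mono_mul1 : left_id mono_one mono_mul.
Proof. by case=> e m n; rewrite /mono_mul /= expo_dot0l subr0 !add0r. Qed.

Lemma mono_mulr1 : right_id mono_one mono_mul.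
Proof. by case=> e m n; rewrite /mono_mul /= expo_dot0r subr0 !addr0. Qed.

Lemma mono_mulV : left_inverse mono_one mono_inv mono_mul.
Proof.
move=> x; rewrite /mono_mul /mono_inv /= !addNr expo_dotNl.
by congr Mono; ring.
Qed.

Lemma mono_mulrV : right_inverse mono_one mono_inv mono_mul.
Proof.
move=> x; rewrite /mono_mul /mono_inv /= !addrN expo_dotNr.
by congr Mono; ring.
Qed.

HB.instance Definition _ := isGroup.Build mono
  mono_mulA mono_mul1 mono_mulr1 mono_mulV mono_mulrV.

Definition expo_unit (i : 'I_6) : expo := [ffun l => (l == i)%:Z].
Definition mono_q : mono := Mono 1 0 0.
Definition gen_a (i : 'I_6) : mono := Mono 0 (expo_unit i) 0.
Definition gen_b (i : 'I_6) : mono := Mono 0 0 (expo_unit i).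

Lemma gen_abC (i j : 'I_6) :
  (gen_a i * gen_b j = mono_q ^+ (i == j) * gen_b j * gen_a i)%g.
Proof.
have dotE : expo_dot (expo_unit j) (expo_unit i) = (i == j)%:Z.
  rewrite /expo_dot (bigD1 j) //= !ffunE eqxx mul1r (eq_sym j i).
  by rewrite big1 ?addr0 // => l /negbTE lj; rewrite ffunE lj mul0r.
case: (i == j) dotE => dotE; rewrite ?mul1g;
  congr Mono; rewrite /= ?expo_dot0l ?expo_dot0r ?add0r ?addr0 ?subr0 ?dotE //;
  by rewrite addrC.
Qed.

Lemma gen_aC (i j : 'I_6) : (gen_a i * gen_a j = gen_a j * gen_a i)%g.
Proof. by congr Mono; rewrite /= ?expo_dot0l // addrC. Qed.

Lemma gen_bC (i j : 'I_6) : (gen_b i * gen_b j = gen_b j * gen_b i)%g.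
Proof. by congr Mono; rewrite /= ?expo_dot0r // addrC. Qed.

Definition mono_expz (x : mono) (z : int) : mono :=
  match z with Posz n => (x ^+ n)%g | Negz n => (x ^- n.+1)%g end.

(* The automorphism F_ijk, on generators and then on q^e a^m b^n. *)
Definition cal_F_a (i j k l : 'I_6) : mono :=
  if l == j then (gen_a i * gen_a k)%g
  else if l == k then ((gen_a i)^-1 * gen_a j)%g
  else gen_a l.

Definition cal_F_b (i j k l : 'I_6) : mono :=
  if l == i then (gen_b i * gen_b j * (gen_b k)^-1)%g
  else if l == j then gen_b k
  else if l == k then gen_b j
  else gen_b l.

Definition cal_F (i j k : 'I_6) (x : mono) : mono :=
  (mono_expz mono_q (qdeg x)
   * (\prod_(l < 6) mono_expz (cal_F_a i j k l) (adeg x l))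
   * (\prod_(l < 6) mono_expz (cal_F_b i j k l) (bdeg x l)))%g.

Definition w (r s : int) (i j k : 'I_6) : mono :=
  (mono_expz (gen_a i) (r - s) * mono_expz (gen_a j) (s - r)
   * gen_b i * (gen_b k)^-1 * mono_expz (gen_a k) (s + 1))%g.

Definition wtilde (r s : int) (i j k : 'I_6) : mono :=
  (mono_expz (gen_a k) (s - r) * gen_b i * (gen_b k)^-1
   * mono_expz (gen_a i) (- s - 1) * mono_expz (gen_a j) (s + 1))%g.

(* (x, g) stands for the monomial x followed by the formal element generating
   the outer automorphism g; products of such elements multiply as the
   automorphisms do, and g x = g(x) g. *)
Definition word : Type := (mono * (mono -> mono))%type.

Definition word_mul (x y : word) : word := ((x.1 * x.2 y.1)%g, x.2 \o y.2).

(* The basis element underlying a word, once its power of q is dropped. *)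
Definition word_key (x : word) : expo * expo * (mono -> mono) :=
  (adeg x.1, bdeg x.1, x.2).

(* A formal, possibly infinite, sum of words with coefficients in K, multiplied
   termwise. *)
Record fexpr (K : Type) := FExpr {
  fidx : choiceType;
  fcoef : fidx -> K;
  fword : fidx -> word
}.

Section FormalExpressions.
Variable K : fieldType.
Implicit Types (A B : fexpr K) (c : nat -> K).

Definition fmul A B : fexpr K :=
  FExpr (fun t : fidx A * fidx B => fcoef t.1 * fcoef t.2)
        (fun t : fidx A * fidx B => word_mul (fword t.1) (fword t.2)).

Definition fouter (g : mono -> mono) : fexpr K :=
  FExpr (fun _ : unit => 1) (fun _ : unit => (1%g, g)).

Definition fone : fexpr K := fouter id.

Definition fsummable A : Prop :=
  forall z, finite_set [set t | word_key (fword t) = z /\ fcoef (f := A) t != 0].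

(* The coefficient of a basis element, for K-scalar q: every word (e, m, n, g)
   contributes its coefficient times q^e. *)
Definition fcollect (q : K) A (z : expo * expo * (mono -> mono)) : K :=
  \sum_(t \in [set t | word_key (fword t) = z])
     fcoef (f := A) t * q ^ qdeg (fword t).1.

(* Without summability the finitely supported sums in fcollect are junk, so it
   is part of the meaning of an equality between formal expressions. *)
Definition feq (q : K) A B : Prop :=
  [/\ fsummable A, fsummable B & forall z, fcollect q A z = fcollect q B z].

(* A power series in K[[t]] is its sequence of coefficients. *)
Definition fps_invertible c : Prop :=
  exists d : nat -> K,
    forall n, \sum_(l < n.+1) c l * d (n - l)%N = (n == 0%N)%:R.

Definition fps_scale (lam : K) c : nat -> K := fun n => lam ^+ n * c n.

Definition fps_eval c (x : mono) : fexpr K := FExpr c (fun n => ((x ^+ n)%g, id)).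

Definition qdilog (p : K) : nat -> K :=
  fun n => (-1) ^+ n / \prod_(1 <= l < n.+1) (1 - p ^+ l).

Definition Rmat (q : K) (r s : int) (f : K -> nat -> K) (i j k : 'I_6) (lam : K)
    : fexpr K :=
  fmul (fmul (fps_eval (f lam) (wtilde r s i j k))
             (fps_eval (fps_scale lam (qdilog (q ^ (r + 1)))) (w r s i j k)))
       (fouter (cal_F i j k)).

End FormalExpressions.

Definition ind1 : 'I_6 := @Ordinal 6 0 isT.
Definition ind2 : 'I_6 := @Ordinal 6 1 isT.
Definition ind3 : 'I_6 := @Ordinal 6 2 isT.
Definition ind4 : 'I_6 := @Ordinal 6 3 isT.
Definition ind5 : 'I_6 := @Ordinal 6 4 isT.
Definition ind6 : 'I_6 := @Ordinal 6 5 isT.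

(* Main.v *)
Require Import Defs.
From mathcomp Require Import all_boot all_order all_algebra.
From mathcomp Require Import all_classical reals complex ring zify.
Import Order.TTheory GRing.Theory Num.Theory.
Local Open Scope ring_scope.
Local Open Scope complex_scope.

(** The involution property forces the product of [f] with the quantum dilogarithm
    <lambda x>_p, p = q^(r+1), to be a constant eps with eps^2 = 1, since [wtilde]
    and [w] are algebraically independent; so f(wtilde) is, up to the sign eps, the
    inverse of a dilogarithm.  Moving the outer automorphisms to the right turns
    each side of the tetrahedron equation into an ordered product of eight
    series, four in monomials coming from [w] and four in monomials coming from
    [wtilde].  The two families commute with each other, and in each of them the
    equation follows from two pentagon identities
    <A><B> = <B><BA><A> for AB = pBA (or their inverses).  The signs agree by
    the hypothesis on the constant terms of [f]. *)

Set Implicit Arguments.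
Unset Strict Implicit.
Unset Printing Implicit Defensive.

(** Products of infinite sums of Laurent monomials make sense only if finitely many terms meet in
    each basis element. Instead of a completed algebra, a grading by the exponents of the b's is
    chosen for which the monomials of all series have positive degree and which the automorphisms
    preserve. A formal sum is then known through its pairings with functions that vanish in high
    degree; every such pairing is a finite sum, and extracting a coefficient is one of them. The
    weights are those of [expo_unit i] for the square of one R, and (2,1,1,0,0,0) for the four R's
    together.

    The monomials of the two families p-commute in opposite orders. Inversion reverses a product, so
    the inverse dilogarithms of the [wtilde] family satisfy the same exchange relations as the
    dilogarithms of the [w] family.

    The involution sees only eps^2, so eps may vary with the spectral parameter. The two sides share
    the signs at lam, mu and nu; the remaining ones, at lam*mu and at lam*nu, are what the
    hypothesis on constant terms compares. *)

Ltac solve_incl := let t := fresh in let h := fresh in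
  move=> t /= h; repeat (case: h => [->|h]; first by repeat first [by left | right]);
  case: h.

(** The bound [N] survives the shift, because the terms that the shift brings in beyond [N]
    vanish. *)
Lemma big_ord_shift (V : nmodType) (N m : nat) (F : nat -> V) :
  (forall n, (N <= n)%N -> F n = 0) ->
  \sum_(n < N) F (n + m)%N = \sum_(n < N | (m <= n)%N) F n.
Proof.
move=> F0; transitivity (\sum_(m <= n < N + m) F n).
  by rewrite -{2}[m]add0n big_addn addnK big_mkord.
have -> : \sum_(n < N | (m <= n)%N) F n = \sum_(m <= n < N) F n.
  by rewrite big_geq_mkord.
have [mN|Nm] := leqP m N; last first.
  rewrite [RHS]big_geq ?(ltnW Nm) // big1_seq // => n /andP[_].
  by rewrite mem_index_iota => /andP[mn _]; apply/F0/ltnW/(leq_trans Nm).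
rewrite (big_cat_nat (n := N)) ?leq_addr //= [X in _ + X]big1_seq ?addr0 //.
by move=> n; rewrite mem_index_iota => /andP[_ /andP[/F0]].
Qed.

Lemma mono_qC z a : (a * Mono z 0 0 = Mono z 0 0 * a)%g.
Proof.
by congr Mono; rewrite /= ?expo_dot0l ?expo_dot0r ?subr0 ?add0r ?addr0 // addrC.
Qed.

(** * Gradings by the exponents of the b's *)

Section Degree.
Variable e : expo.

(** Only the b's carry weight: the a-exponents of [w] and [wtilde] vary in sign with r and s, while
    their b-part is always b_i b_k^-1. *)
Definition deg (x : mono) : int := expo_dot (bdeg x) e.

Lemma degM x y : deg (x * y)%g = deg x + deg y.
Proof. exact: expo_dotDl. Qed.

Lemma deg1 : deg 1%g = 0.
Proof. exact: expo_dot0l. Qed.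

Lemma degX x n : deg (x ^+ n)%g = deg x *+ n.
Proof.
elim: n => [|n IHn]; first by rewrite expg0 deg1.
by rewrite expgS degM IHn mulrS.
Qed.

End Degree.

(** * Formal sums as functionals on truncated test functions *)

Section Functionals.
Variables (K : fieldType) (q : K) (e : expo).
Implicit Types (T : mono -> K) (c d : nat -> K) (x y : mono) (s u v : seq ((nat -> K) * mono)).

(* A formal sum of monomials is represented by the linear functional that it
   induces on the functions [T] below; multiplication of formal sums becomes
   nesting of functionals. *)
Definition test T : Prop :=
  (exists N : nat, forall x, N%:Z <= deg e x -> T x = 0) /\
  (forall z x, T (Mono z 0 0 * x)%g = q ^ z * T x).

(** For a test [T] and [x] of positive degree the support is finite; a sum with infinite support
    would take the default value 0. *)
Definition ev c x T : K := \sum_(n \in [set: nat]) c n * T (x ^+ n)%g.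

Fixpoint evs s T : K :=
  if s is (c, x) :: s' then ev c x (fun a => evs s' (fun b => T (a * b)%g))
  else T 1%g.

Definition positive x := 0 < deg e x.

Lemma degX_ge x n : positive x -> n%:Z <= deg e (x ^+ n)%g.
Proof.
rewrite /positive degX; move: (deg e x) => z z0.
by rewrite -mulr_natr natz; nia.
Qed.

Lemma evE c x T (N : nat) :
  (forall n, (N <= n)%N -> T (x ^+ n)%g = 0) ->
  ev c x T = \sum_(n < N) c n * T (x ^+ n)%g.
Proof.
move=> T0; rewrite (fsbig_ord _ _ (fun n => c n * T (x ^+ n)%g)).
apply/esym/fsbig_widen => // n [_ /= /negP]; rewrite -leqNgt => /T0 ->.
exact: mulr0.
Qed.

Arguments evE {c x T} N _.

Lemma eq_ev c x T T' : T =1 T' -> ev c x T = ev c x T'.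
Proof. by move=> /funext ->. Qed.

Lemma eq_evs s T T' : T =1 T' -> evs s T = evs s T'.
Proof. by move=> /funext ->. Qed.

Lemma evZ (k : K) c x T : ev c x (fun a => k * T a) = k * ev c x T.
Proof.
by rewrite /ev mulr_fsumr; apply: eq_fsbigr => n _; rewrite mulrCA.
Qed.

Lemma evsZ (k : K) s T : evs s (fun a => k * T a) = k * evs s T.
Proof.
elim: s T => [|[c x] s IHs] T //=; rewrite -evZ.
by apply: eq_ev => a; rewrite IHs.
Qed.

Lemma evs_cat s s' T :
  evs (s ++ s') T = evs s (fun a => evs s' (fun b => T (a * b)%g)).
Proof.
elim: s T => [|[c x] s IHs] T /=.
  by apply: eq_evs => b; rewrite mul1g.
apply: eq_ev => a; rewrite IHs; apply: eq_evs => b; apply: eq_evs => b'.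
by rewrite mulgA.
Qed.

Lemma test_mull a T : 0 <= deg e a -> test T -> test (fun b => T (a * b)%g).
Proof.
move=> a0 [[N TN] Tq]; split.
  by exists N => x Nx; apply: TN; rewrite degM -[N%:Z]add0r lerD.
by move=> z x; rewrite -Tq !mulgA mono_qC.
Qed.

Lemma test_ev c x T : positive x -> test T ->
  test (fun b => ev c x (fun a => T (b * a)%g)).
Proof.
move=> x0 [[N TN] Tq]; split.
  exists N => y Ny; rewrite (evE 0) ?big_ord0 // => n _.
  apply: TN; rewrite degM -[N%:Z]addr0 lerD // degX.
  by rewrite mulrn_wge0 // ltW.
move=> z y; rewrite -evZ; apply: eq_ev => a.
by rewrite -Tq mulgA.
Qed.

Definition all_pos s := forall t, List.In t s -> positive t.2.

Lemma all_pos_cons c x s : positive x -> all_pos s -> all_pos ((c, x) :: s).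
Proof. by move=> x0 s0 t [<-|/s0]. Qed.

Lemma all_pos_consl t s : all_pos (t :: s) -> positive t.2.
Proof. by move=> s0; apply: s0; left. Qed.

Lemma all_pos_consr t s : all_pos (t :: s) -> all_pos s.
Proof. by move=> s0 t' ts; apply: s0; right. Qed.

(** Right factors of a product can be absorbed into the test, which lets an identity be used to the
    left of further series. *)
Lemma test_evs s T : all_pos s -> test T ->
  test (fun b => evs s (fun a => T (b * a)%g)).
Proof.
elim: s T => [|[c x] s IHs] T s0 Tt /=.
  by under eq_fun do rewrite mulg1.
have /= x0 := all_pos_consl s0; have {}s0 := all_pos_consr s0.
have Ht := test_ev c x0 (IHs T s0 Tt).
have -> // : (fun b => ev c x (fun a => evs s (fun b0 => T (b * (a * b0))%g))) =
  (fun b => ev c x (fun a => evs s (fun a0 => T (b * a * a0)%g))).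
by apply: funext => b; apply: eq_ev => a; apply: eq_evs => a0; rewrite mulgA.
Qed.

(** * Equality of ordered products of series *)

Definition eqs s s' := forall T, test T -> evs s T = evs s' T.

(* Tests are only stable under left translation by monomials of nonnegative
   degree, which are the only ones that a positive list produces. *)
Lemma eq_ev_pos c x T T' : positive x ->
  (forall a, 0 <= deg e a -> T a = T' a) -> ev c x T = ev c x T'.
Proof.
move=> x0 TT'; apply: eq_fsbigr => n _; rewrite TT' // degX.
by rewrite mulrn_wge0 // ltW.
Qed.

Lemma eq_evs_pos s T T' : all_pos s ->
  (forall a, 0 <= deg e a -> T a = T' a) -> evs s T = evs s T'.
Proof.
elim: s T T' => [|[c x] s IHs] T T' s0 TT' /=; first by apply: TT'; rewrite deg1.
apply: eq_ev_pos => [|a a0]; first exact: (all_pos_consl s0).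
apply: IHs => [|b b0]; first exact: all_pos_consr s0.
by apply: TT'; rewrite degM addr_ge0.
Qed.

(** The right context is absorbed into the test, and the left one acts by translations of
    nonnegative degree; the identity is applied to the resulting test. *)
Lemma eqs_ctx u s s' v : all_pos u -> all_pos v -> eqs s s' ->
  eqs (u ++ s ++ v) (u ++ s' ++ v).
Proof.
move=> u0 v0 ss' T Tt; rewrite !evs_cat.
apply: eq_evs_pos => // a a0; rewrite !evs_cat; apply: ss'.
exact: test_evs v0 (test_mull a0 Tt).
Qed.

Lemma eqs_trans s2 s1 s3 : eqs s1 s2 -> eqs s2 s3 -> eqs s1 s3.
Proof. by move=> h1 h2 T Tt; rewrite h1 // h2. Qed.

Lemma eqs_sym s1 s2 : eqs s1 s2 -> eqs s2 s1.
Proof. by move=> h T Tt; rewrite h. Qed.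

Definition scale_coef (k : K) c : nat -> K := fun n => k * c n.

Lemma evs_scale u (k : K) c x v T :
  evs (u ++ (scale_coef k c, x) :: v) T = k * evs (u ++ (c, x) :: v) T.
Proof.
rewrite !evs_cat -evsZ; apply: eq_evs => a /=; rewrite /ev mulr_fsumr.
by apply: eq_fsbigr => n _; rewrite /scale_coef mulrA.
Qed.

Lemma test_bound T : test T -> exists N : nat, forall a, N%:Z <= deg e a -> T a = 0.
Proof. by case. Qed.

(** One bound [N] serves both indices: each monomial has positive degree, so its powers from the
    [N]-th on already have degree at least [N], and the other factor cannot lower it. *)
Lemma evs2E c x d y T (N : nat) : positive x -> positive y ->
  (forall a, N%:Z <= deg e a -> T a = 0) ->
  evs [:: (c, x); (d, y)] T =
    \sum_(m < N) \sum_(n < N) c m * d n * T (x ^+ m * y ^+ n)%g.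
Proof.
move=> x0 y0 TN /=.
have inner a : 0 <= deg e a -> ev d y (fun b => T (a * (b * 1))%g) =
    \sum_(n < N) d n * T (a * y ^+ n)%g.
  move=> a0; rewrite (evE N) => [|n Nn].
    by apply: eq_bigr => n _; rewrite mulg1.
  apply: TN; rewrite mulg1 degM -[N%:Z]add0r lerD //.
  by apply: le_trans (degX_ge n y0); rewrite lez_nat.
rewrite (eq_ev_pos _ x0 inner) (evE N) => [|n Nn].
  by apply: eq_bigr => m _; rewrite mulr_sumr; apply: eq_bigr => n _; rewrite mulrA.
apply: big1 => m _; rewrite TN ?mulr0 // degM -[N%:Z]addr0 lerD //.
  by apply: le_trans (degX_ge n x0); rewrite lez_nat.
by apply: le_trans (degX_ge m y0).
Qed.

Arguments evs2E {c x d y T} N _ _ _.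

Lemma evs3E c x d y c' z T (N : nat) : positive x -> positive y -> positive z ->
  (forall a, N%:Z <= deg e a -> T a = 0) ->
  evs [:: (c, x); (d, y); (c', z)] T =
    \sum_(m < N) \sum_(k < N) \sum_(n < N)
      c m * d k * c' n * T (x ^+ m * y ^+ k * z ^+ n)%g.
Proof.
move=> x0 y0 z0 TN; rewrite -cat1s evs_cat.
have H a : 0 <= deg e a -> evs [:: (d, y); (c', z)] (fun b => T (a * b)%g) =
    \sum_(k < N) \sum_(n < N) d k * c' n * T (a * y ^+ k * z ^+ n)%g.
  move=> a0; rewrite (evs2E N) // => [|b Nb].
    by apply: eq_bigr => k _; apply: eq_bigr => n _; rewrite mulgA.
  by apply: TN; rewrite degM -[N%:Z]add0r lerD.
rewrite (eq_evs_pos (s := [:: (c, x)]) _ H); last by apply: all_pos_cons => // ? [].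
rewrite /= (evE N) => [|n Nn].
  apply: eq_bigr => m _; rewrite mulr_sumr; apply: eq_bigr => k _.
  by rewrite mulr_sumr; apply: eq_bigr => n _; rewrite mulg1 !mulrA.
apply: big1 => k _; apply: big1 => m _; rewrite mulg1 TN ?mulr0 //.
rewrite !degM -addrA -[N%:Z]addr0 lerD //.
  by apply: le_trans (degX_ge n x0); rewrite lez_nat.
by rewrite addr_ge0 //; [apply: le_trans (degX_ge k y0) | apply: le_trans (degX_ge m z0)].
Qed.

Arguments evs3E {c x d y c' z T} N _ _ _ _.

Lemma eqs_comm c x d y : positive x -> positive y -> (x * y = y * x)%g ->
  eqs [:: (c, x); (d, y)] [:: (d, y); (c, x)].
Proof.
move=> x0 y0 xy T /test_bound [N TN].
rewrite !(evs2E N) // exchange_big /=; apply: eq_bigr => n _.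
apply: eq_bigr => m _; rewrite [d n * _]mulrC; congr (_ * T _).
exact: commuteX2.
Qed.

Definition conv c d : nat -> K := fun n => \sum_(l < n.+1) c l * d (n - l)%N.

Lemma eqs_conv c d x : positive x ->
  eqs [:: (c, x); (d, x)] [:: (conv c d, x)].
Proof.
move=> x0 T /test_bound [N TN].
have T0 n : (N <= n)%N -> T (x ^+ n)%g = 0.
  by move=> Nn; apply: TN; apply: le_trans (degX_ge n x0); rewrite lez_nat.
rewrite (evs2E N) //= (evE N) => [|n Nn]; last by rewrite mulg1 T0.
(* The inner index becomes the total exponent of [x]. *)
transitivity (\sum_(m < N) \sum_(n < N | (m <= n)%N) c m * d (n - m)%N * T (x ^+ n)%g).
  apply: eq_bigr => m _; pose F n := c m * d (n - m)%N * T (x ^+ n)%g.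
  rewrite -(@big_ord_shift _ _ _ F) => [|n Nn]; last by rewrite /F T0 ?mulr0.
  by apply: eq_bigr => n _; rewrite /F addnK -expgnDr addnC.
rewrite (exchange_big_dep xpredT) //=; apply: eq_bigr => n _.
rewrite mulg1 mulr_suml.
rewrite (big_ord_widen N (fun m => c m * d (n - m)%N * T (x ^+ n)%g)) ?ltn_ord //.
Qed.

(** * Coefficient form of the pentagon identity *)

Section QDilog.
Variable p : K.
Hypothesis p_order : forall n, p ^+ n.+1 != 1.
Let g := qdilog p.

Lemma qdilog0 : g 0%N = 1.
Proof. by rewrite /g /qdilog big_geq // expr0 divr1. Qed.

(** This is the coefficient form of <p x> = (1 + x) <x>. *)
Lemma qdilogS n : (1 - p ^+ n.+1) * g n.+1 = - g n.
Proof.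
have p1 : 1 - p ^+ n.+1 != 0 by rewrite subr_eq0 eq_sym.
rewrite /g /qdilog big_nat_recr //= (exprS (-1)) invfM.
have := divff p1; set P := (\prod_(_ <= _ < _) _)^-1.
set D := 1 - _; set D' := D^-1 => DD'.
transitivity (- ((-1) ^+ n * P) * (D * D')); first by ring.
by rewrite DD' mulr1.
Qed.

(** The guard matters: truncated subtraction would turn the coefficient for k > n into [g 0], which
    is 1. *)
Let lowered k n := if (k <= n)%N then g (n - k)%N else 0.

Lemma loweredS k m : (1 - p ^+ (m.+1 - k)) * lowered k m.+1 = - lowered k m.
Proof.
rewrite /lowered; case: (ltngtP k m.+1) => [|km|->].
- by rewrite ltnS => km; rewrite km subSn // qdilogS.
- by rewrite leqNgt (ltnW km) /= mulr0 oppr0.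
- by rewrite subnn expr0 subrr mul0r ltnn oppr0.
Qed.

(** The coefficient of B^n A^m in <B><BA><A>, where k is the exponent taken from the middle series
    and the power of p comes from (BA)^k = p^(k choose 2) B^k A^k. *)
Definition pentagon_coef N m n :=
  \sum_(k < N) p ^+ 'C(k, 2) * lowered k n * g k * lowered k m.

(** The factor 1 - p^(m+1) is split as (1 - p^(m+1-k)) + p^(m+1-k) (1 - p^k): the first part lowers
    the index of the A-series, the second that of the middle series. *)
Lemma pentagon_coefS N m n :
  (1 - p ^+ m.+1) * pentagon_coef N.+1 m.+1 n =
    - pentagon_coef N.+1 m n - (if n is n'.+1 then p ^+ m * pentagon_coef N m n' else 0).
Proof.
have split_term k : (1 - p ^+ m.+1) * lowered k m.+1 =
    - lowered k m + p ^+ (m.+1 - k) * (1 - p ^+ k) * lowered k m.+1.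
  have [km|mk] := leqP k m.+1; last first.
    by rewrite -loweredS /lowered leqNgt mk /= !mulr0 addr0.
  rewrite -loweredS -mulrDl; congr (_ * _).
  by rewrite -{1}(subnK km) exprD; ring.
rewrite /pentagon_coef mulr_sumr.
under eq_bigr => k _ do rewrite mulrCA split_term mulrDr mulrN.
rewrite big_split /= sumrN; congr (_ + _).
(* The term k = 0 carries the factor 1 - p^0 = 0; reindexing by k+1 then lowers the bound from
   [N.+1] to [N]. *)
rewrite big_ord_recl expr0 subrr mulr0 mul0r mulr0 add0r.
case: n => [|n].
  by rewrite oppr0 big1 // => k _; rewrite {1}/lowered /= !(mulr0, mul0r).
rewrite mulr_sumr -sumrN; apply: eq_bigr => k _.
rewrite lift0 subSS.
have -> : lowered k.+1 n.+1 = lowered k n by rewrite /lowered subSS.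
have -> : lowered k.+1 m.+1 = lowered k m by rewrite /lowered subSS.
have [km|mk] := leqP k m; last by rewrite {2 4}/lowered leqNgt mk /= !mulr0 oppr0.
have -> : p ^+ m = p ^+ (m - k) * p ^+ k by rewrite -exprD subnK.
(* The p^k gained from (k+1 choose 2) = (k choose 2) + k is what completes p^(m-k) to p^m. *)
rewrite binS bin1 exprD.
transitivity (p ^+ 'C(k, 2) * p ^+ k * lowered k n * p ^+ (m - k) * lowered k m *
   ((1 - p ^+ k.+1) * g k.+1)); first by ring.
by rewrite qdilogS; ring.
Qed.

(** The right side is the coefficient of B^n A^m in <A><B>, and it obeys the same recursion in m.
    Terms with k > m vanish, so a bound above m loses nothing. *)
Lemma pentagon_coefE N m n : (m < N)%N ->
  pentagon_coef N m n = g m * g n * p ^+ (m * n).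
Proof.
elim: m N n => [|m IHm] [//|N] n mN.
  rewrite /pentagon_coef big_ord_recl big1 ?addr0 => [|k _].
    by rewrite /lowered /= subn0 expr0 subn0 qdilog0 !mulr1 !mul1r.
  by rewrite {2}/lowered /= mulr0.
have p1 : 1 - p ^+ m.+1 != 0 by rewrite subr_eq0 eq_sym.
apply: (mulfI p1); rewrite pentagon_coefS IHm; last exact: ltnW.
rewrite [RHS]mulrA [X in _ = X * _]mulrA qdilogS; case: n => [|n]; first by rewrite /= !muln0 subr0 !mulNr.
have gn : g n = - ((1 - p ^+ n.+1) * g n.+1) by rewrite qdilogS opprK.
by rewrite IHm // gn mulSn mulnS !exprD; ring.
Qed.
End QDilog.

(** * The pentagon identity for p-commuting monomials *)

Section Pentagon.
Variables (z : int) (A B : mono).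
Hypotheses (A0 : positive A) (B0 : positive B).
Hypothesis AB : (A * B = Mono z 0 0 * (B * A))%g.
Let p := q ^ z.
Hypothesis p_order : forall n, p ^+ n.+1 != 1.

Lemma mono_qM (a b : int) : (Mono a 0 0 * Mono b 0 0 = Mono (a + b) 0 0)%g.
Proof. by congr Mono; rewrite /= ?expo_dot0l ?subr0 ?addr0. Qed.

Lemma mono_q1 : Mono 0 0 0 = 1%g. Proof. by []. Qed.

Lemma expz_natmul n : q ^ (z *+ n) = p ^+ n.
Proof. by rewrite /p exprnP exprz_exp -mulr_natr natz. Qed.

Lemma qcommX m n :
  (A ^+ m * B ^+ n = Mono (z *+ (m * n)) 0 0 * (B ^+ n * A ^+ m))%g.
Proof.
have AnB k : (A * B ^+ k = Mono (z *+ k) 0 0 * (B ^+ k * A))%g.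
  elim: k => [|k IHk]; first by rewrite !expg0 mulr0n mono_q1 !mul1g mulg1.
  rewrite expgS mulgA AB -mulgA -[(B * A * _)%g]mulgA IHk.
  by rewrite [(B * (Mono _ _ _ * _))%g]mulgA mono_qC -mulgA mulgA mono_qM !mulgA mulrS.
elim: m => [|m IHm]; first by rewrite mul0n mulr0n mono_q1 !expg0 !mul1g mulg1.
rewrite expgS -mulgA IHm mulgA mono_qC -mulgA [(A * (_ * _))%g]mulgA AnB.
by rewrite !mulgA mono_qM mulSn [(n + _)%N]addnC mulrnDr.
Qed.

Lemma mulX k : ((B * A) ^+ k = Mono (z *+ 'C(k, 2)) 0 0 * (B ^+ k * A ^+ k))%g.
Proof.
elim: k => [|k IHk]; first by rewrite !expg0 mulr0n mono_q1 !mul1g.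
rewrite expgS IHk mulgA mono_qC -!mulgA [(A * (_ * _))%g]mulgA.
have := qcommX 1 k; rewrite expg1 mul1n => ->.
rewrite !mulgA -[(_ * B * Mono _ _ _)%g]mulgA mono_qC.
rewrite [(Mono _ _ _ * (Mono _ _ _ * B))%g]mulgA mono_qM.
by rewrite !expgS -!mulgA binS bin1 mulrnDr.
Qed.

(** Both sides are brought to the normal order B^i A^j, where the identity is one of coefficients.
    The scalars match because each BA consumes one A and one B. *)
Lemma eqs_pentagon (l m : K) :
  eqs [:: (fps_scale l (qdilog p), A); (fps_scale m (qdilog p), B)]
      [:: (fps_scale m (qdilog p), B); (fps_scale (l * m) (qdilog p), (B * A)%g);
          (fps_scale l (qdilog p), A)].
Proof.
move=> T Tt; have [N TN] := test_bound Tt; have [_ Tq] := Tt.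
have BA0 : positive (B * A)%g by rewrite /positive degM addr_gt0.
rewrite (evs2E N) // (evs3E N) //.
pose t i j := T (B ^+ i * A ^+ j)%g.
have t0 i j : (N <= i)%N || (N <= j)%N -> t i j = 0.
  move=> Nij; apply: TN; rewrite degM.
  have := degX_ge i B0; have := degX_ge j A0; lia.
pose c := qdilog p.
transitivity (\sum_(j < N) \sum_(i < N) l ^+ j * m ^+ i * pentagon_coef p N j i * t i j).
  apply: eq_bigr => j _; apply: eq_bigr => i _.
  rewrite pentagon_coefE ?ltn_ord // qcommX Tq expz_natmul /fps_scale /t; ring.
pose F i j k := l ^+ j * m ^+ i * (p ^+ 'C(k, 2) * c (i - k)%N * c k * c (j - k)%N) * t i j.
(* Here i and j are total exponents of B and A; the shifts by k below recover the exponents of the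
   outer two series. *)
transitivity (\sum_(k < N) \sum_(i < N | (k <= i)%N) \sum_(j < N | (k <= j)%N) F i j k).
  rewrite exchange_big /=.
  transitivity (\sum_(i < N) \sum_(k < N) \sum_(j < N)
      if (k <= i)%N && (k <= j)%N then F i j k else 0).
    apply: eq_bigr => i _; rewrite exchange_big /=; apply: eq_bigr => j _.
    rewrite /pentagon_coef mulr_sumr mulr_suml; apply: eq_bigr => k _.
    by rewrite /F; case: (k <= i)%N; case: (k <= j)%N; rewrite /= ?(mulr0, mul0r).
  rewrite exchange_big /=; apply: eq_bigr => k _.
  rewrite [RHS]big_mkcond; apply: eq_bigr => i _; case: ifP => _ /=.
    by rewrite [RHS]big_mkcond.
  exact: big1.
rewrite [RHS]exchange_big; apply: eq_bigr => k _ /=.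
rewrite -(@big_ord_shift _ _ _ (fun i => \sum_(j < N | (k <= j)%N) F i j k)); last first.
  by move=> i Ni; apply: big1 => j _; rewrite /F t0 ?Ni // mulr0.
apply: eq_bigr => i _.
rewrite -(@big_ord_shift _ _ _ (fun j => F (i + k)%N j k)); last first.
  by move=> j Nj; rewrite /F t0 ?Nj ?orbT // mulr0.
apply: eq_bigr => j _.
rewrite mulX [(B ^+ i * _)%g]mulgA mono_qC -!mulgA Tq expz_natmul -expgnDr.
rewrite [(B ^+ i * _)%g]mulgA -expgnDr [(k + j)%N]addnC -/(t _ _).
rewrite /F !addnK /fps_scale exprMn !exprD -/c -/p; ring.
Qed.
End Pentagon.

(** * Inverse series and rearrangements of products *)

Definition unit_coef : nat -> K := fun n => (n == 0%N)%:R.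

Lemma conv_comm c d : conv c d =1 conv d c.
Proof.
move=> n; rewrite /conv (reindex_inj rev_ord_inj); apply: eq_bigr => l _ /=.
by rewrite mulrC subSS subKn // -ltnS.
Qed.

Lemma eqs_cancel c d x : positive x -> conv c d =1 unit_coef ->
  eqs [:: (c, x); (d, x)] [::].
Proof.
move=> x0 cd; apply: eqs_trans (eqs_conv c d x0) _ => T /test_bound [N TN] /=.
rewrite (evE N.+1) => [|n Nn]; last first.
  by rewrite mulg1 TN //; apply: le_trans (degX_ge n x0); rewrite lez_nat ltnW.
rewrite big_ord_recl big1 => [|n _]; first by rewrite cd /unit_coef mul1r addr0 expg0 mulg1.
by rewrite cd /unit_coef mul0r.
Qed.

Lemma eqs_step u s s' v r : all_pos u -> all_pos v -> eqs s s' ->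
  eqs (u ++ s' ++ v) r -> eqs (u ++ s ++ v) r.
Proof. by move=> u0 v0 /(eqs_ctx u0 v0); apply: eqs_trans. Qed.

(** Inverting both sides of a pentagon reverses the order of the factors. The inversion is done by
    inserting cancelling pairs on the right until the long side of the pentagon appears. *)
Lemma eqs_inverse_pentagon a b ab a' b' ab' (A B C : mono) :
  positive A -> positive B -> positive C ->
  conv a a' =1 unit_coef -> conv b b' =1 unit_coef -> conv ab ab' =1 unit_coef ->
  eqs [:: (a, A); (b, B)] [:: (b, B); (ab, C); (a, A)] ->
  eqs [:: (b', B); (a', A)] [:: (a', A); (ab', C); (b', B)].
Proof.
move=> A0 B0 C0 aa bb abab pent.
have cancelr c c' x : positive x -> conv c c' =1 unit_coef -> eqs [:: (c, x); (c', x)] [::].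
  by move=> x0 cc; apply: eqs_cancel.
have cancell c c' x : positive x -> conv c c' =1 unit_coef -> eqs [:: (c', x); (c, x)] [::].
  by move=> x0 cc; apply: eqs_cancel => // n; rewrite conv_comm.
have pos t : List.In t [:: (a, A); (b, B); (ab, C); (a', A); (b', B); (ab', C)] -> positive t.2.
  by move=> /=; do ?case=> [<-|] //.
have p s : (forall t, List.In t s ->
    List.In t [:: (a, A); (b, B); (ab, C); (a', A); (b', B); (ab', C)]) -> all_pos s.
  by move=> sub t /sub; apply: pos.
refine (@eqs_step [:: (b', B); (a', A)] [::] [:: (b, B); (b', B)] [::] _ _ _ _ _);
  [by apply: p; solve_incl | by apply: p; solve_incl | exact/eqs_sym/cancelr |].
refine (@eqs_step [:: (b', B); (a', A); (b, B)] [::] [:: (ab, C); (ab', C)] [:: (b', B)] _ _ _ _ _);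
  [by apply: p; solve_incl | by apply: p; solve_incl | exact/eqs_sym/cancelr |].
refine (@eqs_step [:: (b', B); (a', A); (b, B); (ab, C)] [::] [:: (a, A); (a', A)]
    [:: (ab', C); (b', B)] _ _ _ _ _);
  [by apply: p; solve_incl | by apply: p; solve_incl | exact/eqs_sym/cancelr |].
(* The pentagon is used from its long side to its short side, which leaves only adjacent inverse
   pairs to cancel. *)
refine (@eqs_step [:: (b', B); (a', A)] [:: (b, B); (ab, C); (a, A)] [:: (a, A); (b, B)]
    [:: (a', A); (ab', C); (b', B)] _ _ _ _ _);
  [by apply: p; solve_incl | by apply: p; solve_incl | exact/eqs_sym |].
refine (@eqs_step [:: (b', B)] [:: (a', A); (a, A)] [::]
    [:: (b, B); (a', A); (ab', C); (b', B)] _ _ _ _ _);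
  [by apply: p; solve_incl | by apply: p; solve_incl | exact: cancell |].
refine (@eqs_step [::] [:: (b', B); (b, B)] [::] [:: (a', A); (ab', C); (b', B)] _ _ _ _ _);
  [by apply: p; solve_incl | by apply: p; solve_incl | exact: cancell | by []].
Qed.

(** The chain is xyzv = xzyv = zuxyv = zuvx = zvux: one pentagon creates u and the other absorbs
    y. *)
Lemma eqs_tetrahedron (x y z v u : (nat -> K) * mono) : all_pos [:: x; y; z; v; u] ->
  eqs [:: y; z] [:: z; y] -> eqs [:: u; v] [:: v; u] ->
  eqs [:: x; z] [:: z; u; x] -> eqs [:: v; x] [:: x; y; v] ->
  eqs [:: x; y; z; v] [:: z; v; u; x].
Proof.
move=> pos yz uv xz vx.
have p s : (forall t, List.In t s -> List.In t [:: x; y; z; v; u]) -> all_pos s.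
  by move=> sub t /sub; apply: pos.
refine (@eqs_step [:: x] [:: y; z] [:: z; y] [:: v] _ _ _ _ _);
  [by apply: p; solve_incl | by apply: p; solve_incl | exact: yz |].
refine (@eqs_step [::] [:: x; z] [:: z; u; x] [:: y; v] _ _ _ _ _);
  [by apply: p; solve_incl | by apply: p; solve_incl | exact: xz |].
refine (@eqs_step [:: z; u] [:: x; y; v] [:: v; x] [::] _ _ _ _ _);
  [by apply: p; solve_incl | by apply: p; solve_incl | exact: eqs_sym |].
refine (@eqs_step [:: z] [:: u; v] [:: v; u] [:: x] _ _ _ _ _);
  [by apply: p; solve_incl | by apply: p; solve_incl | exact: uv | by []].
Qed.

(** Each primed factor moves left past the unprimed ones before it. The order within each family is
    unchanged, so only relations between the families are needed. *)
Lemma eqs_unshuffle (x x' y y' z z' v v' : (nat -> K) * mono) :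
  all_pos [:: x; x'; y; y'; z; z'; v; v'] ->
  eqs [:: x; y'] [:: y'; x] -> eqs [:: x; z'] [:: z'; x] -> eqs [:: x; v'] [:: v'; x] ->
  eqs [:: y; z'] [:: z'; y] -> eqs [:: y; v'] [:: v'; y] -> eqs [:: z; v'] [:: v'; z] ->
  eqs [:: x'; x; y'; y; z'; z; v'; v] [:: x'; y'; z'; v'; x; y; z; v].
Proof.
move=> pos xy xz xv yz yv zv.
have p s : (forall t, List.In t s -> List.In t [:: x; x'; y; y'; z; z'; v; v']) -> all_pos s.
  by move=> sub t /sub; apply: pos.
refine (@eqs_step [:: x'] [:: x; y'] [:: y'; x] [:: y; z'; z; v'; v] _ _ _ _ _);
  [by apply: p; solve_incl | by apply: p; solve_incl | exact: xy |].
refine (@eqs_step [:: x'; y'; x] [:: y; z'] [:: z'; y] [:: z; v'; v] _ _ _ _ _);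
  [by apply: p; solve_incl | by apply: p; solve_incl | exact: yz |].
refine (@eqs_step [:: x'; y'] [:: x; z'] [:: z'; x] [:: y; z; v'; v] _ _ _ _ _);
  [by apply: p; solve_incl | by apply: p; solve_incl | exact: xz |].
refine (@eqs_step [:: x'; y'; z'; x; y] [:: z; v'] [:: v'; z] [:: v] _ _ _ _ _);
  [by apply: p; solve_incl | by apply: p; solve_incl | exact: zv |].
refine (@eqs_step [:: x'; y'; z'; x] [:: y; v'] [:: v'; y] [:: z; v] _ _ _ _ _);
  [by apply: p; solve_incl | by apply: p; solve_incl | exact: yv |].
refine (@eqs_step [:: x'; y'; z'] [:: x; v'] [:: v'; x] [:: y; z; v] _ _ _ _ _);
  [by apply: p; solve_incl | by apply: p; solve_incl | exact: xv |].
by [].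
Qed.

(** * Formal expressions with outer automorphisms *)

Definition pres (g : mono -> mono) := forall x, deg e (g x) = deg e x.

(** Vanishing is asked only where the outer part preserves the degree, since otherwise the degree of
    a product of words is not the sum of their degrees. *)
Definition wtest (T : word -> K) := exists N : nat,
  forall u : word, pres u.2 -> N%:Z <= deg e u.1 -> T u = 0.

Definition graded (A : fexpr K) :=
  [/\ forall t : fidx A, 0 <= deg e (fword t).1,
      forall t : fidx A, pres (fword t).2 &
      forall N : nat, finite_set [set t : fidx A | deg e (fword t).1 < N%:Z]].

Definition fpair (A : fexpr K) (T : word -> K) :=
  \sum_(t \in [set: fidx A]) fcoef t * T (fword t).

Lemma fpair_trunc (A : fexpr K) (T : word -> K) (N : nat) :
  (forall t : fidx A, N%:Z <= deg e (fword t).1 -> T (fword t) = 0) ->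
  fpair A T = \sum_(t \in [set t : fidx A | deg e (fword t).1 < N%:Z]) fcoef t * T (fword t).
Proof.
move=> TN; apply/esym/fsbig_widen => // t [_ /= /negP]; rewrite -leNgt => /TN ->.
exact: mulr0.
Qed.

(** A Fubini exchange, reduced to finite sums: degrees are nonnegative and add up, so only pairs
    with both degrees below [N] contribute. *)
Lemma fpair_mul (A B : fexpr K) (T : word -> K) : graded A -> graded B -> wtest T ->
  fpair (fmul A B) T = fpair A (fun u : word => fpair B (fun v : word => T (word_mul u v))).
Proof.
move=> [A0 Ap Af] [B0 Bp Bf] [N TN].
have pm (t : fidx A) (t' : fidx B) : pres (word_mul (fword t) (fword t')).2.
  by move=> x; rewrite /= Ap Bp.
have dm (t : fidx A) (t' : fidx B) :
    deg e (word_mul (fword t) (fword t')).1 = deg e (fword t).1 + deg e (fword t').1.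
  by rewrite /= degM Ap.
have inner (t : fidx A) : fpair B (fun v : word => T (word_mul (fword t) v)) =
    \sum_(t' \in [set t' : fidx B | deg e (fword t').1 < N%:Z])
      fcoef t' * T (word_mul (fword t) (fword t')).
  apply: fpair_trunc => t' Nt'; apply: TN => //.
  by rewrite dm -[N%:Z]add0r lerD.
rewrite [RHS](@fpair_trunc _ _ N); last first.
  move=> t Nt; rewrite inner big1 // => t' _; rewrite TN ?mulr0 //.
  by rewrite dm -[N%:Z]addr0 lerD.
transitivity (\sum_(t \in [set t : fidx A | deg e (fword t).1 < N%:Z])
   \sum_(t' \in [set t' : fidx B | deg e (fword t').1 < N%:Z])
     fcoef t * fcoef t' * T (word_mul (fword t) (fword t'))); last first.
  apply: eq_fsbigr => t _; rewrite inner mulr_fsumr; apply: eq_fsbigr => t' _.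
  by rewrite mulrA.
rewrite pair_fsbig //.
apply/esym/fsbig_widen => // -[t t'] [_ /=]; rewrite /setX /= => nlt.
rewrite TN ?mulr0 // dm leNgt; apply/negP => lt; apply: nlt.
have := A0 t; have := B0 t'; move: lt; set a := deg _ _; set b := deg _ _ => *; split; lia.
Qed.

Implicit Types (A B : fexpr K).

Lemma graded_mul A B : graded A -> graded B -> graded (fmul A B).
Proof.
move=> [A0 Ap Af] [B0 Bp Bf]; split.
- by move=> t /=; rewrite degM Ap addr_ge0.
- by move=> t x; rewrite /= Ap Bp.
move=> N; apply: sub_finite_set (finite_setX (Af N) (Bf N)) => -[t t'] /=.
rewrite degM Ap /setX /=; have := A0 t; have := B0 t'.
set a := deg _ _; set b := deg _ _ => *; split; lia.
Qed.

Lemma graded_outer g : pres g -> graded (fouter K g).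
Proof.
move=> gp; split=> //= t; first by rewrite deg1.
Qed.

Lemma graded_fps c x : positive x -> graded (fps_eval c x).
Proof.
move=> x0; split=> //= [n|N]; first by rewrite degX mulrn_wge0 // ltW.
apply: sub_finite_set (finite_II N) => n /=; rewrite -ltz_nat.
exact/le_lt_trans/degX_ge.
Qed.

(** [A] is the ordered product of the series in [s] followed by the single outer automorphism [g];
    the grading is recorded so that this form is stable under products. *)
Definition rep (A : fexpr K) s g := graded A /\
  forall T : word -> K, wtest T -> fpair A T = evs s (fun a => T (a, g)).

Definition hom (g : mono -> mono) := {morph g : x y / (x * y)%g}.

Lemma hom1 g : hom g -> g 1%g = 1%g.
Proof. by move=> gM; apply: (mulgI (g 1%g)); rewrite -gM !mulg1. Qed.

Lemma homX g x n : hom g -> g (x ^+ n)%g = (g x ^+ n)%g.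
Proof.
move=> gM; elim: n => [|n IHn]; first by rewrite !expg0 hom1.
by rewrite !expgS gM IHn.
Qed.

Lemma evs_hom g s T : hom g ->
  evs s (fun a => T (g a)) = evs [seq (t.1, g t.2) | t <- s] T.
Proof.
move=> gM; elim: s T => [|[c x] s IHs] T /=; first by rewrite hom1.
rewrite /ev; apply: eq_fsbigr => n _; congr (_ * _); rewrite -homX // -IHs.
by apply: eq_evs => b; rewrite gM.
Qed.

(** Moving [g] to the right by g x = g(x) g applies it to the monomials of the second factor. *)
Lemma rep_mul A B s s' g g' : hom g -> pres g ->
  rep A s g -> rep B s' g' ->
  rep (fmul A B) (s ++ [seq (t.1, g t.2) | t <- s']) (g \o g').
Proof.
move=> gM gp [gA rA] [gB rB]; split=> [|T Tt]; first exact: graded_mul.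
rewrite fpair_mul // rA; last first.
  case: Tt gB => N TN [B0 Bp _]; exists N => u up Nu.
  rewrite /fpair big1 // => t _.
  rewrite TN ?mulr0 //= => [x|]; first by rewrite /= up Bp.
  by rewrite degM up -[N%:Z]addr0 lerD.
rewrite evs_cat; apply: eq_evs => a.
rewrite rB -?evs_hom //; case: Tt => N TN.
(* [a] is arbitrary here and may have negative degree. *)
exists (N + `|deg e a|)%N => u up Nu; apply: TN => [x|]; first by rewrite /= gp up.
by rewrite /= degM gp; move: Nu; set b := deg _ _; set b' := deg _ _; lia.
Qed.

Lemma rep_outer g : pres g -> rep (fouter K g) [::] g.
Proof.
move=> gp; split=> [|T _]; first exact: graded_outer.
transitivity (\sum_(t \in [set (tt : fidx (fouter K g))]) fcoef t * T (fword t)).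
  by apply: eq_fsbigl; apply/seteqP; split=> -[].
by rewrite fsbig_set1 mul1r.
Qed.

Lemma rep_fps c x : positive x -> rep (fps_eval c x) [:: (c, x)] id.
Proof.
move=> x0; split=> [|T _]; first exact: graded_fps.
by rewrite /= /fpair /ev; apply: eq_fsbigr => n _; rewrite mulg1.
Qed.

(** The functional that reads the coefficient of the basis element [z] in a sum of words ending in
    [g]. *)
Definition test_of (z : expo * expo * (mono -> mono)) (g : mono -> mono) (a : mono) : K :=
  if (adeg a, bdeg a, g) == z then q ^ qdeg a else 0.

Hypothesis q0 : q != 0.

Lemma test_of_test z g : test (test_of z g).
Proof.
split.
  exists (absz (expo_dot z.1.2 e)).+1 => a; rewrite /test_of.
  case: eqP => // <- /=; rewrite /deg; set d := expo_dot _ _; lia.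
move=> k a; rewrite /test_of /= !add0r expo_dot0l subr0.
by case: ifP => _; rewrite ?mulr0 // expfzDr.
Qed.

(** Words with the same key have the same b-exponents, hence the same degree, so finiteness in
    bounded degree gives summability. *)
Lemma rep_collect A s g z : rep A s g -> fsummable A /\ fcollect q A z = evs s (test_of z g).
Proof.
move=> [[A0 Ap Af] rA]; split.
  move=> z'; apply: sub_finite_set (Af (absz (expo_dot z'.1.2 e)).+1) => t /= [<- _].
  by rewrite /deg /=; set d := expo_dot _ _; lia.
transitivity (fpair A (fun u : word => if word_key u == z then q ^ qdeg u.1 else 0)).
  rewrite /fcollect fsbig_mkcond; apply: eq_fsbigr => t _; rewrite /patch.
  case: eqP => tz; first by rewrite mem_set.
  by rewrite memNset // mulr0.
rewrite rA // ; exists (absz (expo_dot z.1.2 e)).+1 => u _; case: eqP => // <- /=.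
by rewrite /deg; set d := expo_dot _ _; lia.
Qed.

Lemma feq_rep A B s s' g : rep A s g -> rep B s' g -> eqs s s' -> feq q A B.
Proof.
move=> rA rB ss'; split=> [||z].
- exact: (rep_collect (0, 0, id) rA).1.
- exact: (rep_collect (0, 0, id) rB).1.
by rewrite (rep_collect z rA).2 (rep_collect z rB).2; apply/ss'/test_of_test.
Qed.
End Functionals.

(** * The automorphisms as reflections of the exponent lattices *)

Section Automorphism.
Implicit Types (m n : expo) (i j k l : 'I_6) (x y : mono).

Definition expo_scale (z : int) m : expo := [ffun l => m l * z].

Definition mono_a m := Mono 0 m 0.
Definition mono_b n := Mono 0 0 n.

Lemma mono_aD m m' : mono_a (m + m') = (mono_a m * mono_a m')%g.
Proof. by congr Mono; rewrite /= ?expo_dot0l ?addr0. Qed.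

Lemma mono_bD n n' : mono_b (n + n') = (mono_b n * mono_b n')%g.
Proof. by congr Mono; rewrite /= ?expo_dot0r ?addr0. Qed.

Lemma mono_aN m : mono_a (- m) = (mono_a m)^-1%g.
Proof. by congr Mono; rewrite /= ?expo_dot0l ?oppr0 ?subr0. Qed.

Lemma mono_bN n : mono_b (- n) = (mono_b n)^-1%g.
Proof. by congr Mono; rewrite /= ?expo_dot0r ?oppr0 ?subr0. Qed.

Lemma mono_expz_morph (f : int -> mono) z : f 0 = 1%g ->
  {morph f : a b / a + b >-> (a * b)%g} -> mono_expz (f 1) z = f z.
Proof.
move=> f0 fD; have fX (t : int) (n : nat) : (f t ^+ n)%g = f (t *+ n).
  elim: n => [|n IHn]; first by rewrite expg0 mulr0n f0.
  by rewrite expgS IHn -fD mulrS.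
case: z => n /=; rewrite fX ?natz //.
by apply/(mulgI (f n.+1%:Z)); rewrite mulgV -fD NegzE subrr f0.
Qed.

Lemma mono_expz_a z m : mono_expz (mono_a m) z = mono_a (expo_scale z m).
Proof.
rewrite -(@mono_expz_morph (fun z => mono_a (expo_scale z m))) /=.
- by congr (mono_expz (mono_a _) _); apply/ffunP => l; rewrite !ffunE mulr1.
- by congr Mono; apply/ffunP => l; rewrite !ffunE mulr0.
by move=> a b; rewrite -mono_aD; congr mono_a; apply/ffunP => l; rewrite !ffunE mulrDr.
Qed.

Lemma mono_expz_b z n : mono_expz (mono_b n) z = mono_b (expo_scale z n).
Proof.
rewrite -(@mono_expz_morph (fun z => mono_b (expo_scale z n))) /=.
- by congr (mono_expz (mono_b _) _); apply/ffunP => l; rewrite !ffunE mulr1.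
- by congr Mono; apply/ffunP => l; rewrite !ffunE mulr0.
by move=> a b; rewrite -mono_bD; congr mono_b; apply/ffunP => l; rewrite !ffunE mulrDr.
Qed.

Lemma mono_expz_q z : mono_expz mono_q z = Mono z 0 0.
Proof. by rewrite -(@mono_expz_morph (fun z => Mono z 0 0)) // => a b; rewrite mono_qM. Qed.

(** With alpha = [root_a] and beta = [root_b], the automorphism acts on a-exponents by m -> m +
    (beta.m) alpha and on b-exponents by the transpose n -> n + (alpha.n) beta. *)
Definition root_a i j k : expo := expo_unit i - expo_unit j + expo_unit k.
Definition root_b j k : expo := expo_unit j - expo_unit k.

Section Explicit.
Variables i j k : 'I_6.
Hypotheses (ij : i != j) (ik : i != k) (jk : j != k).

Lemma cal_F_aE l :
  cal_F_a i j k l = mono_a (expo_unit l + expo_scale (root_b j k l) (root_a i j k)).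
Proof.
have ga v : gen_a v = mono_a (expo_unit v) by [].
rewrite /cal_F_a !ga -!mono_aN -!mono_aD.
case: (eqVneq l j) => [->|lj]; last case: (eqVneq l k) => [->|lk]; congr mono_a;
  apply/ffunP => v; rewrite !ffunE ?eqxx ?(negbTE jk) ?(eq_sym k j) ?(negbTE jk)
    ?(negbTE lj) ?(negbTE lk) /=; ring.
Qed.

Lemma cal_F_bE l :
  cal_F_b i j k l = mono_b (expo_unit l + expo_scale (root_a i j k l) (root_b j k)).
Proof.
have gb v : gen_b v = mono_b (expo_unit v) by [].
rewrite /cal_F_b !gb -!mono_bN -!mono_bD.
case: (eqVneq l i) => [->|li]; last case: (eqVneq l j) => [->|lj];
  last case: (eqVneq l k) => [->|lk]; congr mono_b;
  apply/ffunP => v; rewrite !ffunE ?eqxx ?(negbTE ij) ?(negbTE ik) ?(negbTE jk)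
    ?(eq_sym k j) ?(eq_sym j i) ?(eq_sym k i) ?(negbTE ij) ?(negbTE ik) ?(negbTE jk)
    ?(negbTE li) ?(negbTE lj) ?(negbTE lk) /=; ring.
Qed.

Lemma sum_expo_scale (v u m : expo) :
  \sum_(l < 6) expo_scale (m l) (expo_unit l + expo_scale (v l) u) =
  m + expo_scale (expo_dot v m) u.
Proof.
apply/ffunP => t; rewrite sum_ffunE !ffunE /expo_dot mulr_sumr.
under eq_bigr do rewrite !ffunE mulrDl.
rewrite big_split /=; congr (_ + _); last by apply: eq_bigr => l _; rewrite mulrA.
rewrite (bigD1 t) //= eqxx mul1r big1 ?addr0 // => l /negbTE lt.
by rewrite eq_sym lt mul0r.
Qed.

(** No power of q appears, because the images of the a's involve only a's and those of the b's only
    b's. *)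
Lemma cal_FE x : cal_F i j k x =
  Mono (qdeg x) (adeg x + expo_scale (expo_dot (root_b j k) (adeg x)) (root_a i j k))
    (bdeg x + expo_scale (expo_dot (root_a i j k) (bdeg x)) (root_b j k)).
Proof.
rewrite /cal_F mono_expz_q.
under eq_bigr do rewrite cal_F_aE mono_expz_a.
under [X in (_ * X)%g]eq_bigr do rewrite cal_F_bE mono_expz_b.
have -> v : (\prod_(l < 6) mono_a (v l))%g = mono_a (\sum_(l < 6) v l).
  by apply/esym/(big_morph mono_a) => //; exact: mono_aD.
have -> v : (\prod_(l < 6) mono_b (v l))%g = mono_b (\sum_(l < 6) v l).
  by apply/esym/(big_morph mono_b) => //; exact: mono_bD.
rewrite !sum_expo_scale.
by congr Mono; rewrite /= ?expo_dot0l ?expo_dot0r ?subr0 ?addr0 ?add0r.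
Qed.

Lemma expo_dotC m n : expo_dot m n = expo_dot n m.
Proof. by apply: eq_bigr => l _; rewrite mulrC. Qed.

Lemma expo_dotZr m (z : int) n : expo_dot m (expo_scale z n) = expo_dot m n * z.
Proof. by rewrite /expo_dot mulr_suml; apply: eq_bigr => l _; rewrite ffunE mulrA. Qed.

Lemma expo_dotZl m (z : int) n : expo_dot (expo_scale z m) n = expo_dot m n * z.
Proof. by rewrite expo_dotC expo_dotZr expo_dotC. Qed.

Lemma expo_dot_unit m l : expo_dot m (expo_unit l) = m l.
Proof.
rewrite /expo_dot (bigD1 l) //= ffunE eqxx mulr1 big1 ?addr0 // => t /negbTE tl.
by rewrite ffunE tl mulr0.
Qed.

(** The value -2 makes both actions reflections. It yields the involutivity, and the invariance of
    the pairing of b- with a-exponents that makes the map multiplicative. *)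
Lemma root_dot : expo_dot (root_b j k) (root_a i j k) = - 2.
Proof.
rewrite /root_a !(expo_dotDr, expo_dotNr, expo_dot_unit) !ffunE !eqxx.
by rewrite (eq_sym k j) (negbTE ij) (negbTE ik) (negbTE jk).
Qed.

Lemma cal_F_hom : hom (cal_F i j k).
Proof.
move=> x y; rewrite !cal_FE; have := root_dot.
move: (root_a _ _ _) (root_b _ _) => al be bal; congr Mono => /=.
- rewrite !(expo_dotDl, expo_dotDr, expo_dotZl, expo_dotZr) bal.
  by rewrite (expo_dotC (bdeg x) al); ring.
- by apply/ffunP => l; rewrite expo_dotDr !ffunE; ring.
- by apply/ffunP => l; rewrite expo_dotDr !ffunE; ring.
Qed.

(** The b-exponents change by multiples of [root_b], whose weight is e_j - e_k. *)
Lemma cal_F_pres (e : expo) : e j = e k -> pres e (cal_F i j k).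
Proof.
move=> ejk x; rewrite cal_FE /deg /= expo_dotDl expo_dotZl.
rewrite (expo_dotC (root_b j k)) expo_dotDr expo_dotNr !expo_dot_unit ejk.
by rewrite subrr mul0r addr0.
Qed.

(** The power of q comes from moving a_k^(s+1) to the left of b_k^-1. In [wtilde] the same power
    comes from a_i^(-s-1) and b_i, as it must for the automorphism to exchange the two. *)
Lemma wE (r s : int) : w r s i j k = Mono (s + 1)
  (expo_scale (r - s) (expo_unit i) + expo_scale (s - r) (expo_unit j)
    + expo_scale (s + 1) (expo_unit k)) (expo_unit i - expo_unit k).
Proof.
have ga v : gen_a v = mono_a (expo_unit v) by [].
have gb v : gen_b v = mono_b (expo_unit v) by [].
rewrite /w !ga !gb !mono_expz_a -mono_bN; congr Mono => /=.
- rewrite !(expo_dot0l, expo_dot0r, expo_dotDl, expo_dotNl, expo_dotZr, expo_dot_unit).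
  by rewrite !ffunE eqxx (eq_sym k i) (negbTE ik) /=; ring.
- by apply/ffunP => l; rewrite !ffunE; ring.
- by apply/ffunP => l; rewrite !ffunE; ring.
Qed.

Lemma wtildeE (r s : int) : wtilde r s i j k = Mono (s + 1)
  (expo_scale (s - r) (expo_unit k) + expo_scale (- s - 1) (expo_unit i)
    + expo_scale (s + 1) (expo_unit j)) (expo_unit i - expo_unit k).
Proof.
have ga v : gen_a v = mono_a (expo_unit v) by [].
have gb v : gen_b v = mono_b (expo_unit v) by [].
rewrite /wtilde !ga !gb !mono_expz_a -mono_bN; congr Mono => /=.
- rewrite !(expo_dot0l, expo_dot0r, expo_dotDl, expo_dotNl, expo_dotZr, expo_dot_unit).
  by rewrite !ffunE ?eqxx ?(eq_sym k i) ?(eq_sym j i) ?(eq_sym k j) ?(negbTE ij) ?(negbTE ik) ?(negbTE jk) /=; ring.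
- by apply/ffunP => l; rewrite !ffunE; ring.
- by apply/ffunP => l; rewrite !ffunE; ring.
Qed.

Lemma cal_F_w r s : cal_F i j k (w r s i j k) = wtilde r s i j k.
Proof.
rewrite cal_FE wE wtildeE /root_a /root_b /=.
rewrite !(expo_dotDl, expo_dotNl, expo_dotDr, expo_dotNr, expo_dotZr, expo_dot_unit).
have := (eqxx i, eqxx j, eqxx k, negbTE ij, negbTE ik, negbTE jk) => E.
have := (eq_sym j i, eq_sym k i, eq_sym k j) => E'.
congr Mono; apply/ffunP => l; rewrite !ffunE !E' !E /=; ring.
Qed.

Lemma cal_FK : involutive (cal_F i j k).
Proof.
move=> x; rewrite !cal_FE /=; have := root_dot.
move: (root_a _ _ _) (root_b _ _) => al be bal.
rewrite !expo_dotDr !expo_dotZr bal (expo_dotC al be) bal.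
case: x => d m n /=; congr Mono; apply/ffunP => l; rewrite !ffunE; ring.
Qed.
End Explicit.

End Automorphism.

(** * What the involution says about f *)

Section Involution.
Variables (K : fieldType) (q : K).
Hypothesis q0 : q != 0.

Lemma hom_id : hom id. Proof. by []. Qed.
Lemma pres_id e : pres e id. Proof. by []. Qed.

Lemma rep_Rmat (e : expo) (r s : int) (f : K -> nat -> K) (i j k : 'I_6) l :
  pres e (cal_F i j k) -> positive e (w r s i j k) -> positive e (wtilde r s i j k) ->
  rep e (Rmat q r s f i j k l)
    [:: (f l, wtilde r s i j k); (fps_scale l (qdilog (q ^ (r + 1))), w r s i j k)]
    (cal_F i j k).
Proof.
move=> Fp w0 w0'.
have := rep_mul hom_id (@pres_id e) (rep_fps (f l) w0')
  (rep_fps (fps_scale l (qdilog (q ^ (r + 1)))) w0).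
by move/rep_mul/(_ (rep_outer K Fp)); apply.
Qed.

Lemma adegX (x : mono) n : adeg (x ^+ n)%g = expo_scale n%:Z (adeg x).
Proof.
elim: n => [|n IHn]; first by apply/ffunP => l; rewrite expg0 !ffunE mulr0.
by rewrite expgS /= IHn; apply/ffunP => l; rewrite !ffunE intS; ring.
Qed.

Lemma bdegX (x : mono) n : bdeg (x ^+ n)%g = expo_scale n%:Z (bdeg x).
Proof.
elim: n => [|n IHn]; first by apply/ffunP => l; rewrite expg0 !ffunE mulr0.
by rewrite expgS /= IHn; apply/ffunP => l; rewrite !ffunE intS; ring.
Qed.

Variables (r s : int) (i j k : 'I_6) (f g : nat -> K).
Hypotheses (ij : i != j) (ik : i != k) (jk : j != k) (r1 : r != -1).
Let W := w r s i j k.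
Let W' := wtilde r s i j k.

Lemma w_wtildeC : (W * W' = W' * W)%g.
Proof.
rewrite /W /W' wE // wtildeE //; congr Mono => /=; try by rewrite addrC.
rewrite !(expo_dotDl, expo_dotNl, expo_dotDr, expo_dotNr, expo_dotZr, expo_dot_unit).
have E := (eqxx i, eqxx j, eqxx k, negbTE ij, negbTE ik, negbTE jk).
have E' := (eq_sym j i, eq_sym k i, eq_sym k j).
by rewrite !ffunE !E' !E /=; ring.
Qed.

(** Coordinate [i] decides: the b-exponents give n0 = m + n, and then the a-exponents give m (r + 1)
    = 0. *)
Lemma w_wtilde_free (m n n0 : nat) :
  adeg (W' ^+ m * W ^+ n)%g = adeg (W ^+ n0)%g ->
  bdeg (W' ^+ m * W ^+ n)%g = bdeg (W ^+ n0)%g -> m = 0%N /\ n = n0.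
Proof.
rewrite /= !adegX !bdegX /W /W' wE // wtildeE //= => /ffunP /(_ i) aE /ffunP /(_ i).
move: aE; have E := (eqxx i, eqxx j, eqxx k, negbTE ij, negbTE ik, negbTE jk).
have E' := (eq_sym j i, eq_sym k i, eq_sym k j).
rewrite !ffunE !E /=.
move=> aE bE; have mn : n0 = (m + n)%N by lia.
have : m%:Z * (r + 1) = 0 by move: aE; rewrite mn PoszD; lia.
by move/eqP; rewrite mulf_eq0 addr_eq0 (negbTE r1) orbF => /eqP m0; split; lia.
Qed.

Lemma deg_w : deg (expo_unit i) W = 1.
Proof.
rewrite /W wE // /deg /= expo_dot_unit !ffunE eqxx (negbTE ik).
by [].
Qed.

Lemma deg_wtilde : deg (expo_unit i) W' = 1.
Proof.
rewrite /W' wtildeE // /deg /= expo_dot_unit !ffunE eqxx (negbTE ik).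
by [].
Qed.

(** The list is the square of R with its automorphisms moved out. It sorts to h(W') h(W) with h =
    fg, and comparing coefficients of W^n with those of 1 gives h_0 h_n. *)
Lemma involution_conv :
  (forall z, evs [:: (f, W'); (g, W); (f, W); (g, W')] (test_of q z id) =
     test_of q z id 1%g) ->
  forall n, conv f g 0%N * conv f g n = (n == 0%N)%:R.
Proof.
pose e := expo_unit i.
have W0 : positive e W by rewrite /positive deg_w.
have W0' : positive e W' by rewrite /positive deg_wtilde.
have pos u : (forall t, List.In t u ->
    List.In t [:: (f, W'); (g, W); (f, W); (g, W'); (conv f g, W'); (conv f g, W)]) ->
    all_pos e u.
  by move=> sub t /sub /=; do ?case=> [<-|] //.
have sorted : eqs q e [:: (f, W'); (g, W); (f, W); (g, W')]
    [:: (conv f g, W'); (conv f g, W)].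
  refine (@eqs_step _ _ _ [:: (f, W'); (g, W)] [:: (f, W); (g, W')] [:: (g, W'); (f, W)]
    [::] _ _ _ _ _); [by apply: pos; solve_incl | by apply: pos; solve_incl | |].
    exact: eqs_comm w_wtildeC.
  refine (@eqs_step _ _ _ [:: (f, W')] [:: (g, W); (g, W')] [:: (g, W'); (g, W)]
    [:: (f, W)] _ _ _ _ _); [by apply: pos; solve_incl | by apply: pos; solve_incl | |].
    exact: eqs_comm w_wtildeC.
  refine (@eqs_step _ _ _ [::] [:: (f, W'); (g, W')] [:: (conv f g, W')]
    [:: (g, W); (f, W)] _ _ _ _ _); [by apply: pos; solve_incl | by apply: pos; solve_incl | |].
    exact: eqs_conv.
  refine (@eqs_step _ _ _ [:: (conv f g, W')] [:: (g, W); (f, W)] [:: (conv f g, W)]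
    [::] _ _ _ _ _); [by apply: pos; solve_incl | by apply: pos; solve_incl | | by []].
  rewrite (_ : conv f g = conv g f); first exact: eqs_conv.
  by apply: funext => n; exact: conv_comm.
(* This test reads the coefficient of W^n, to which, by freeness, only W'^0 W^n contributes. *)
move=> H n; pose T := test_of q (adeg (W ^+ n)%g, bdeg (W ^+ n)%g, id) id.
have Tt : test q e T by exact: test_of_test.
have [N TN] := test_bound Tt.
have := H (adeg (W ^+ n)%g, bdeg (W ^+ n)%g, id); rewrite -/T sorted //.
(* The truncation bound is raised so that the exponent n lies in its range. *)
have {}TN a : (N + n).+1%:Z <= deg e a -> T a = 0 by move=> Na; apply: TN; lia.
rewrite (@evs2E _ e _ _ _ _ _ (N + n).+1) // big_ord_recl [X in _ + X]big1 ?addr0; last first.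
  move=> m _; apply: big1 => n' _; rewrite /T /test_of; case: eqP; rewrite ?mulr0 //.
  by case=> /w_wtilde_free E /E [].
have nN : (n < (N + n).+1)%N by rewrite ltnS leq_addl.
rewrite (bigD1 (Ordinal nN)) //= [X in _ + X]big1 ?addr0; last first.
  move=> n' /eqP nn; rewrite /T /test_of; case: eqP; rewrite ?mulr0 //.
  by move=> [aE bE]; have [_ n'n] := @w_wtilde_free 0 n' n aE bE; case: nn; apply: val_inj.
rewrite expg0 mul1g /T /test_of eqxx => eq1.
have qn0 : q ^ qdeg (W ^+ n)%g != 0 by rewrite expfz_neq0.
apply: (mulIf qn0); rewrite {}eq1; case: n nN qn0 {T Tt TN} => [|n] nN qn0.
  by rewrite expg0 eqxx mul1r.
rewrite mul0r; case: eqP => // -[_]; rewrite bdegX => /ffunP /(_ i).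
by rewrite /W wE //= !ffunE eqxx (negbTE ik); lia.
Qed.

(** The dilogarithm has constant term 1, so eps is the constant term of [F l]; since eps^2 = 1,
    multiplying [F l] by it gives an exact inverse of the dilogarithm. *)
Lemma Rmat_involution (F : K -> nat -> K) l :
  f = F l -> g = fps_scale l (qdilog (q ^ (r + 1))) ->
  feq q (fmul (Rmat q r s F i j k l) (Rmat q r s F i j k l)) (fone K) ->
  F l 0%N * F l 0%N = 1 /\
  conv (scale_coef (F l 0%N) (F l)) g =1 @unit_coef K.
Proof.
move=> fE gE RR; pose e := expo_unit i.
have Fp : pres e (cal_F i j k).
  by apply: cal_F_pres; rewrite // !ffunE eq_sym (negbTE ij) eq_sym (negbTE ik).
have rR : rep e (Rmat q r s F i j k l) [:: (f, W'); (g, W)] (cal_F i j k).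
  by rewrite fE gE; apply: rep_Rmat; rewrite // /positive ?deg_w ?deg_wtilde.
have rRR := rep_mul (cal_F_hom ij ik jk) Fp rR rR.
have FK : cal_F i j k \o cal_F i j k = id by apply: funext => x /=; rewrite cal_FK.
rewrite FK /= in rRR.
have FW : cal_F i j k W = W' by exact: cal_F_w.
have FW' : cal_F i j k W' = W by rewrite -FW cal_FK.
rewrite FW FW' in rRR.
have r1e := rep_outer K (@pres_id e).
have h : forall n, conv f g 0%N * conv f g n = (n == 0%N)%:R.
  apply: involution_conv => z; have [_ _ /(_ z)] := RR.
  by rewrite (rep_collect q0 z rRR).2 (rep_collect q0 z r1e).2.
have h0 : conv f g 0%N = F l 0%N.
  by rewrite /conv big_ord1 gE fE /fps_scale qdilog0 expr0 !mulr1.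
have hn n : conv (scale_coef (F l 0%N) (F l)) g n = conv f g 0%N * conv f g n.
  rewrite h0 /conv mulr_sumr; apply: eq_bigr => m _.
  by rewrite /scale_coef fE mulrA.
split; first by rewrite -h0 h.
by move=> n; rewrite hn h.
Qed.
End Involution.

(** * Explicit coordinates for the four index triples *)

Section Six.
Implicit Types (m n : expo) (x y : mono).

Definition vec6 (v : seq int) : expo := [ffun l : 'I_6 => nth 0 v l].

Lemma forall6 (P : 'I_6 -> Prop) : P ind1 -> P ind2 -> P ind3 -> P ind4 -> P ind5 -> P ind6 ->
  forall l, P l.
Proof.
move=> P1 P2 P3 P4 P5 P6 [[|[|[|[|[|[|//]]]]]] lt];
  by rewrite (bool_irrelevance lt isT).
Qed.

Lemma expo_dot6 m n : expo_dot m n = m ind1 * n ind1 + m ind2 * n ind2 + m ind3 * n ind3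
  + m ind4 * n ind4 + m ind5 * n ind5 + m ind6 * n ind6.
Proof.
rewrite /expo_dot !big_ord_recl big_ord0 addr0 !addrA.
by congr (m _ * n _ + m _ * n _ + m _ * n _ + m _ * n _ + m _ * n _ + m _ * n _);
  apply: val_inj.
Qed.

Lemma mono_ext6 x y : qdeg x = qdeg y ->
  (forall l, adeg x l = adeg y l) -> (forall l, bdeg x l = bdeg y l) -> x = y.
Proof.
by case: x y => ? ? ? [? ? ?] /= -> /ffunP -> /ffunP ->.
Qed.

Section Coordinates.
Variables i j k : 'I_6.
Hypothesis ijk : [&& i != j, i != k & j != k].

Lemma qdeg_cal_F x : qdeg (cal_F i j k x) = qdeg x.
Proof. by case/and3P: ijk => ij ik jk; rewrite cal_FE. Qed.

Lemma adeg_cal_F x l : adeg (cal_F i j k x) l = adeg x l +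
  (adeg x j - adeg x k) * ((l == i :> nat)%:Z - (l == j :> nat)%:Z + (l == k :> nat)%:Z).
Proof.
case/and3P: ijk => ij ik jk; rewrite cal_FE //= !ffunE expo_dotC expo_dotDr expo_dotNr.
by rewrite !expo_dot_unit mulrC.
Qed.

Lemma bdeg_cal_F x l : bdeg (cal_F i j k x) l = bdeg x l +
  (bdeg x i - bdeg x j + bdeg x k) * ((l == j :> nat)%:Z - (l == k :> nat)%:Z).
Proof.
case/and3P: ijk => ij ik jk; rewrite cal_FE //= !ffunE expo_dotC !expo_dotDr expo_dotNr.
by rewrite !expo_dot_unit mulrC.
Qed.

Lemma adeg_w r s l : adeg (w r s i j k) l =
  (l == i :> nat)%:Z * (r - s) + (l == j :> nat)%:Z * (s - r) + (l == k :> nat)%:Z * (s + 1).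
Proof. by case/and3P: ijk => ij ik jk; rewrite wE //= !ffunE. Qed.

Lemma adeg_wtilde r s l : adeg (wtilde r s i j k) l =
  (l == k :> nat)%:Z * (s - r) + (l == i :> nat)%:Z * (- s - 1) + (l == j :> nat)%:Z * (s + 1).
Proof. by case/and3P: ijk => ij ik jk; rewrite wtildeE //= !ffunE. Qed.

Lemma bdeg_w r s l : bdeg (w r s i j k) l = (l == i :> nat)%:Z - (l == k :> nat)%:Z.
Proof. by case/and3P: ijk => ij ik jk; rewrite wE //= !ffunE. Qed.

Lemma bdeg_wtilde r s l : bdeg (wtilde r s i j k) l = (l == i :> nat)%:Z - (l == k :> nat)%:Z.
Proof. by case/and3P: ijk => ij ik jk; rewrite wtildeE //= !ffunE. Qed.

Lemma qdeg_w r s : qdeg (w r s i j k) = s + 1.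
Proof. by case/and3P: ijk => ij ik jk; rewrite wE. Qed.

Lemma qdeg_wtilde r s : qdeg (wtilde r s i j k) = s + 1.
Proof. by case/and3P: ijk => ij ik jk; rewrite wtildeE. Qed.
End Coordinates.

Lemma vec6E (a b c d e f : int) :
  let v := vec6 [:: a; b; c; d; e; f] in
  ((v ind1 = a) * (v ind2 = b) * (v ind3 = c) * (v ind4 = d) * (v ind5 = e) * (v ind6 = f))%type.
Proof. by rewrite /vec6 /= !ffunE. Qed.

Lemma cal_F123E d a1 a2 a3 a4 a5 a6 b1 b2 b3 b4 b5 b6 :
  cal_F ind1 ind2 ind3 (Mono d (vec6 [:: a1; a2; a3; a4; a5; a6]) (vec6 [:: b1; b2; b3; b4; b5; b6])) =
  Mono d (vec6 [:: a1 + a2 - a3; a3; a2; a4; a5; a6])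
    (vec6 [:: b1; b1 + b3; b2 - b1; b4; b5; b6]).
Proof.
apply: mono_ext6; first by rewrite qdeg_cal_F.
  by apply: forall6; rewrite adeg_cal_F // !ffunE /=; ring.
by apply: forall6; rewrite bdeg_cal_F // !ffunE /=; ring.
Qed.

Lemma cal_F145E d a1 a2 a3 a4 a5 a6 b1 b2 b3 b4 b5 b6 :
  cal_F ind1 ind4 ind5 (Mono d (vec6 [:: a1; a2; a3; a4; a5; a6]) (vec6 [:: b1; b2; b3; b4; b5; b6])) =
  Mono d (vec6 [:: a1 + a4 - a5; a2; a3; a5; a4; a6])
    (vec6 [:: b1; b2; b3; b1 + b5; b4 - b1; b6]).
Proof.
apply: mono_ext6; first by rewrite qdeg_cal_F.
  by apply: forall6; rewrite adeg_cal_F // !ffunE /=; ring.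
by apply: forall6; rewrite bdeg_cal_F // !ffunE /=; ring.
Qed.

Lemma cal_F246E d a1 a2 a3 a4 a5 a6 b1 b2 b3 b4 b5 b6 :
  cal_F ind2 ind4 ind6 (Mono d (vec6 [:: a1; a2; a3; a4; a5; a6]) (vec6 [:: b1; b2; b3; b4; b5; b6])) =
  Mono d (vec6 [:: a1; a2 + a4 - a6; a3; a6; a5; a4])
    (vec6 [:: b1; b2; b3; b2 + b6; b5; b4 - b2]).
Proof.
apply: mono_ext6; first by rewrite qdeg_cal_F.
  by apply: forall6; rewrite adeg_cal_F // !ffunE /=; ring.
by apply: forall6; rewrite bdeg_cal_F // !ffunE /=; ring.
Qed.

Lemma cal_F356E d a1 a2 a3 a4 a5 a6 b1 b2 b3 b4 b5 b6 :
  cal_F ind3 ind5 ind6 (Mono d (vec6 [:: a1; a2; a3; a4; a5; a6]) (vec6 [:: b1; b2; b3; b4; b5; b6])) =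
  Mono d (vec6 [:: a1; a2; a3 + a5 - a6; a4; a6; a5])
    (vec6 [:: b1; b2; b3; b4; b3 + b6; b5 - b3]).
Proof.
apply: mono_ext6; first by rewrite qdeg_cal_F.
  by apply: forall6; rewrite adeg_cal_F // !ffunE /=; ring.
by apply: forall6; rewrite bdeg_cal_F // !ffunE /=; ring.
Qed.

Lemma mono_vec6 x : x = Mono (qdeg x)
  (vec6 [:: adeg x ind1; adeg x ind2; adeg x ind3; adeg x ind4; adeg x ind5; adeg x ind6])
  (vec6 [:: bdeg x ind1; bdeg x ind2; bdeg x ind3; bdeg x ind4; bdeg x ind5; bdeg x ind6]).
Proof. by apply: mono_ext6 => //; apply: forall6; rewrite /= vec6E. Qed.

Variables r s : int.

Lemma w123E : w r s ind1 ind2 ind3 =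
  Mono (s + 1) (vec6 [:: r - s; s - r; s + 1; 0; 0; 0]) (vec6 [:: 1; 0; - 1; 0; 0; 0]).
Proof.
apply: mono_ext6; first by rewrite qdeg_w.
  by apply: forall6; rewrite adeg_w // ffunE /=; ring.
by apply: forall6; rewrite bdeg_w // ffunE /=; ring.
Qed.

Lemma wtilde123E : wtilde r s ind1 ind2 ind3 =
  Mono (s + 1) (vec6 [:: - s - 1; s + 1; s - r; 0; 0; 0]) (vec6 [:: 1; 0; - 1; 0; 0; 0]).
Proof.
apply: mono_ext6; first by rewrite qdeg_wtilde.
  by apply: forall6; rewrite adeg_wtilde // ffunE /=; ring.
by apply: forall6; rewrite bdeg_wtilde // ffunE /=; ring.
Qed.

Lemma w145E : w r s ind1 ind4 ind5 =
  Mono (s + 1) (vec6 [:: r - s; 0; 0; s - r; s + 1; 0]) (vec6 [:: 1; 0; 0; 0; - 1; 0]).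
Proof.
apply: mono_ext6; first by rewrite qdeg_w.
  by apply: forall6; rewrite adeg_w // ffunE /=; ring.
by apply: forall6; rewrite bdeg_w // ffunE /=; ring.
Qed.

Lemma wtilde145E : wtilde r s ind1 ind4 ind5 =
  Mono (s + 1) (vec6 [:: - s - 1; 0; 0; s + 1; s - r; 0]) (vec6 [:: 1; 0; 0; 0; - 1; 0]).
Proof.
apply: mono_ext6; first by rewrite qdeg_wtilde.
  by apply: forall6; rewrite adeg_wtilde // ffunE /=; ring.
by apply: forall6; rewrite bdeg_wtilde // ffunE /=; ring.
Qed.

Lemma w246E : w r s ind2 ind4 ind6 =
  Mono (s + 1) (vec6 [:: 0; r - s; 0; s - r; 0; s + 1]) (vec6 [:: 0; 1; 0; 0; 0; - 1]).
Proof.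
apply: mono_ext6; first by rewrite qdeg_w.
  by apply: forall6; rewrite adeg_w // ffunE /=; ring.
by apply: forall6; rewrite bdeg_w // ffunE /=; ring.
Qed.

Lemma wtilde246E : wtilde r s ind2 ind4 ind6 =
  Mono (s + 1) (vec6 [:: 0; - s - 1; 0; s + 1; 0; s - r]) (vec6 [:: 0; 1; 0; 0; 0; - 1]).
Proof.
apply: mono_ext6; first by rewrite qdeg_wtilde.
  by apply: forall6; rewrite adeg_wtilde // ffunE /=; ring.
by apply: forall6; rewrite bdeg_wtilde // ffunE /=; ring.
Qed.

Lemma w356E : w r s ind3 ind5 ind6 =
  Mono (s + 1) (vec6 [:: 0; 0; r - s; 0; s - r; s + 1]) (vec6 [:: 0; 0; 1; 0; 0; - 1]).
Proof.
apply: mono_ext6; first by rewrite qdeg_w.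
  by apply: forall6; rewrite adeg_w // ffunE /=; ring.
by apply: forall6; rewrite bdeg_w // ffunE /=; ring.
Qed.

Lemma wtilde356E : wtilde r s ind3 ind5 ind6 =
  Mono (s + 1) (vec6 [:: 0; 0; - s - 1; 0; s + 1; s - r]) (vec6 [:: 0; 0; 1; 0; 0; - 1]).
Proof.
apply: mono_ext6; first by rewrite qdeg_wtilde.
  by apply: forall6; rewrite adeg_wtilde // ffunE /=; ring.
by apply: forall6; rewrite bdeg_wtilde // ffunE /=; ring.
Qed.

End Six.

Ltac mono_eq :=
  by congr (Mono _ (vec6 [:: _; _; _; _; _; _]) (vec6 [:: _; _; _; _; _; _])); ring.

Lemma mul_vec6 (d a1 a2 a3 a4 a5 a6 b1 b2 b3 b4 b5 b6 : int)
    (d' a1' a2' a3' a4' a5' a6' b1' b2' b3' b4' b5' b6' : int) :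
  (Mono d (vec6 [:: a1; a2; a3; a4; a5; a6]) (vec6 [:: b1; b2; b3; b4; b5; b6])
   * Mono d' (vec6 [:: a1'; a2'; a3'; a4'; a5'; a6']) (vec6 [:: b1'; b2'; b3'; b4'; b5'; b6']))%g
  = Mono (d + d' - (b1 * a1' + b2 * a2' + b3 * a3' + b4 * a4' + b5 * a5' + b6 * a6'))
     (vec6 [:: a1 + a1'; a2 + a2'; a3 + a3'; a4 + a4'; a5 + a5'; a6 + a6'])
     (vec6 [:: b1 + b1'; b2 + b2'; b3 + b3'; b4 + b4'; b5 + b5'; b6 + b6']).
Proof.
apply: mono_ext6 => /=; first by rewrite expo_dot6 !vec6E.
  by apply: forall6; rewrite ffunE !vec6E.
by apply: forall6; rewrite ffunE !vec6E.
Qed.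

Lemma mul_q_mono z d m n : (Mono z 0 0 * Mono d m n = Mono (z + d) m n)%g.
Proof. by congr Mono; rewrite /= ?expo_dot0l ?subr0 ?add0r. Qed.

(** * The monomials occurring in the tetrahedron equation *)

Section Identities.
Variables r s : int.

Local Notation F123 := (cal_F ind1 ind2 ind3).
Local Notation F145 := (cal_F ind1 ind4 ind5).
Local Notation F246 := (cal_F ind2 ind4 ind6).
Local Notation F356 := (cal_F ind3 ind5 ind6).

Lemma cal_F_tetrahedron : F123 \o F145 \o F246 \o F356 = F356 \o F246 \o F145 \o F123.
Proof.
apply: funext => x; rewrite (mono_vec6 x) /comp.
apply: etrans; first by rewrite cal_F356E cal_F246E cal_F145E cal_F123E.
apply/esym; apply: etrans; first by rewrite cal_F123E cal_F145E cal_F246E cal_F356E.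
by congr (Mono _ (vec6 [:: _; _; _; _; _; _]) (vec6 [:: _; _; _; _; _; _])); ring.
Qed.

(* The arguments of the eight series on each side, once all the outer
   automorphisms have been moved to the right. *)
Definition X := w r s ind1 ind2 ind3.
Definition X' := wtilde r s ind1 ind2 ind3.
Definition Y := F123 (w r s ind1 ind4 ind5).
Definition Y' := F123 (wtilde r s ind1 ind4 ind5).
Definition Z := w r s ind3 ind5 ind6.
Definition Z' := wtilde r s ind3 ind5 ind6.
Definition V := F356 (w r s ind2 ind4 ind6).
Definition V' := F356 (wtilde r s ind2 ind4 ind6).
Definition U := F356 (F246 (w r s ind1 ind4 ind5)).
Definition U' := F356 (F246 (wtilde r s ind1 ind4 ind5)).

(** This and the next five coincidences match factors of the two sides: the left side involves X, Y,
    Z, V and the right side Z, V, U, X, so each family has only five monomials. *)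
Lemma F123_F145_w246 : F123 (F145 (w r s ind2 ind4 ind6)) = Z.
Proof. by rewrite /Z w246E w356E cal_F145E cal_F123E; mono_eq. Qed.

Lemma F123_F145_wtilde246 : F123 (F145 (wtilde r s ind2 ind4 ind6)) = Z'.
Proof. by rewrite /Z' wtilde246E wtilde356E cal_F145E cal_F123E; mono_eq. Qed.

Lemma F123_F145_F246_w356 : F123 (F145 (F246 (w r s ind3 ind5 ind6))) = V.
Proof. by rewrite /V w246E w356E [RHS]cal_F356E cal_F246E cal_F145E cal_F123E; mono_eq. Qed.

Lemma F123_F145_F246_wtilde356 : F123 (F145 (F246 (wtilde r s ind3 ind5 ind6))) = V'.
Proof. by rewrite /V' wtilde246E wtilde356E [RHS]cal_F356E cal_F246E cal_F145E cal_F123E; mono_eq. Qed.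

Lemma F356_F246_F145_w123 : F356 (F246 (F145 (w r s ind1 ind2 ind3))) = X.
Proof. by rewrite /X w123E cal_F145E cal_F246E cal_F356E; mono_eq. Qed.

Lemma F356_F246_F145_wtilde123 : F356 (F246 (F145 (wtilde r s ind1 ind2 ind3))) = X'.
Proof. by rewrite /X' wtilde123E cal_F145E cal_F246E cal_F356E; mono_eq. Qed.

Lemma XE : X = Mono (s + 1)
  (vec6 [:: r - s; s - r; s + 1; 0; 0; 0])
  (vec6 [:: 1; 0; - 1; 0; 0; 0]).
Proof. by rewrite /X w123E ; mono_eq. Qed.

Lemma YE : Y = Mono (s + 1)
  (vec6 [:: r - s; 0; 0; s - r; s + 1; 0])
  (vec6 [:: 1; 1; - 1; 0; - 1; 0]).
Proof. by rewrite /Y w145E cal_F123E; mono_eq. Qed.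

Lemma ZE : Z = Mono (s + 1)
  (vec6 [:: 0; 0; r - s; 0; s - r; s + 1])
  (vec6 [:: 0; 0; 1; 0; 0; - 1]).
Proof. by rewrite /Z w356E ; mono_eq. Qed.

Lemma VE : V = Mono (s + 1)
  (vec6 [:: 0; r - s; - s - 1; s - r; s + 1; 0])
  (vec6 [:: 0; 1; 0; 0; - 1; 0]).
Proof. by rewrite /V w246E cal_F356E; mono_eq. Qed.

Lemma UE : U = Mono (s + 1)
  (vec6 [:: r - s; s - r; r + 1; 0; s - r; s + 1])
  (vec6 [:: 1; 0; 0; 0; 0; - 1]).
Proof. by rewrite /U w145E cal_F246E cal_F356E; mono_eq. Qed.

Lemma X'E : X' = Mono (s + 1)
  (vec6 [:: - s - 1; s + 1; s - r; 0; 0; 0])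
  (vec6 [:: 1; 0; - 1; 0; 0; 0]).
Proof. by rewrite /X' wtilde123E ; mono_eq. Qed.

Lemma Y'E : Y' = Mono (s + 1)
  (vec6 [:: - s - 1; 0; 0; s + 1; s - r; 0])
  (vec6 [:: 1; 1; - 1; 0; - 1; 0]).
Proof. by rewrite /Y' wtilde145E cal_F123E; mono_eq. Qed.

Lemma Z'E : Z' = Mono (s + 1)
  (vec6 [:: 0; 0; - s - 1; 0; s + 1; s - r])
  (vec6 [:: 0; 0; 1; 0; 0; - 1]).
Proof. by rewrite /Z' wtilde356E ; mono_eq. Qed.

Lemma V'E : V' = Mono (s + 1)
  (vec6 [:: 0; - s - 1; r - s; s + 1; s - r; 0])
  (vec6 [:: 0; 1; 0; 0; - 1; 0]).
Proof. by rewrite /V' wtilde246E cal_F356E; mono_eq. Qed.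

Lemma U'E : U' = Mono (s + 1)
  (vec6 [:: - s - 1; s + 1; - r - 1; 0; s + 1; s - r])
  (vec6 [:: 1; 0; 0; 0; 0; - 1]).
Proof. by rewrite /U' wtilde145E cal_F246E cal_F356E; mono_eq. Qed.

Definition monosE := (XE, YE, ZE, VE, UE, X'E, Y'E, Z'E, V'E, U'E).
End Identities.

Ltac mono_calc := rewrite !monosE !mul_vec6 ?mul_q_mono; mono_eq.

(** * Assembly of the tetrahedron equation *)

Section Tetrahedron.
Variables (K : fieldType) (q : K) (r s : int) (f : K -> nat -> K).
Hypothesis q0 : q != 0.
Hypothesis p_order : forall n, (q ^ (r + 1)) ^+ n.+1 != 1.
Let g l := fps_scale l (qdilog (q ^ (r + 1))).
Let d l := scale_coef (f l 0%N) (f l).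
Hypothesis f0 : forall l, f l 0%N * f l 0%N = 1.
Hypothesis dg : forall l, conv (d l) (g l) =1 @unit_coef K.

Local Notation F123 := (cal_F ind1 ind2 ind3).
Local Notation F145 := (cal_F ind1 ind4 ind5).
Local Notation F246 := (cal_F ind2 ind4 ind6).
Local Notation F356 := (cal_F ind3 ind5 ind6).
Local Notation X := (X r s).
Local Notation Y := (Y r s).
Local Notation Z := (Z r s).
Local Notation V := (V r s).
Local Notation U := (U r s).
Local Notation X' := (X' r s).
Local Notation Y' := (Y' r s).
Local Notation Z' := (Z' r s).
Local Notation V' := (V' r s).
Local Notation U' := (U' r s).

(* A grading preserved by the four automorphisms, for which all the monomials
   involved have positive degree. *)
Let e := vec6 [:: 2; 1; 1; 0; 0; 0].

Let pX : positive e X. Proof. by rewrite /positive XE /deg expo_dot6 !vec6E. Qed.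
Let pY : positive e Y. Proof. by rewrite /positive YE /deg expo_dot6 !vec6E. Qed.
Let pZ : positive e Z. Proof. by rewrite /positive ZE /deg expo_dot6 !vec6E. Qed.
Let pV : positive e V. Proof. by rewrite /positive VE /deg expo_dot6 !vec6E. Qed.
Let pU : positive e U. Proof. by rewrite /positive UE /deg expo_dot6 !vec6E. Qed.
Let pX' : positive e X'. Proof. by rewrite /positive X'E /deg expo_dot6 !vec6E. Qed.
Let pY' : positive e Y'. Proof. by rewrite /positive Y'E /deg expo_dot6 !vec6E. Qed.
Let pZ' : positive e Z'. Proof. by rewrite /positive Z'E /deg expo_dot6 !vec6E. Qed.
Let pV' : positive e V'. Proof. by rewrite /positive V'E /deg expo_dot6 !vec6E. Qed.
Let pU' : positive e U'. Proof. by rewrite /positive U'E /deg expo_dot6 !vec6E. Qed.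

(* A syntactic [assumption]: conversion between different monomials is costly. *)
Ltac known := match goal with H : ?P |- ?Q => constr_eq P Q; exact H end.
Ltac list_pos := let t := fresh in let h := fresh in
  intros t h; repeat (destruct h as [h|h];
    [rewrite <- h; cbn beta iota delta [snd]; known|]); destruct h.
Ltac comm := refine (eqs_comm _ _ _ _ _); [known | known | mono_calc].
Ltac pentagon := refine (eqs_pentagon _ _ _ _ _ _); [known | known | mono_calc | exact: p_order].

(** The pentagons apply to XZ = p ZX and VX = p XV with p = q^(r+1); their middle monomials are ZX =
    U and XV = Y. *)
Lemma tetrahedron_plain lam mu nu :
  eqs q e [:: (g lam, X); (g (lam * mu), Y); (g nu, Z); (g mu, V)]
    [:: (g nu, Z); (g mu, V); (g (lam * nu), U); (g lam, X)].
Proof.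
have UE : U = (Z * X)%g by mono_calc.
have YE : Y = (X * V)%g by mono_calc.
refine (eqs_tetrahedron _ _ _ _ _); [list_pos | comm | comm | |].
  by rewrite UE; pentagon.
by rewrite mulrC YE; pentagon.
Qed.

(** Here Z'X' = p X'Z' and X'V' = p V'X', the opposite order to the other family, so the pentagons
    needed are those of the inverse series. *)
Lemma tetrahedron_tilde lam mu nu :
  eqs q e [:: (d lam, X'); (d (lam * mu), Y'); (d nu, Z'); (d mu, V')]
    [:: (d nu, Z'); (d mu, V'); (d (lam * nu), U'); (d lam, X')].
Proof.
have UE : U' = (X' * Z')%g by mono_calc.
have YE : Y' = (V' * X')%g by mono_calc.
have gd l : conv (g l) (d l) =1 @unit_coef K by move=> n; rewrite conv_comm dg.
refine (eqs_tetrahedron _ _ _ _ _); [list_pos | comm | comm | |].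
  rewrite mulrC; apply: (eqs_inverse_pentagon _ _ _ (gd nu) (gd lam) (gd (nu * lam))); [known ..|].
  by rewrite UE; pentagon.
apply: (eqs_inverse_pentagon _ _ _ (gd lam) (gd mu) (gd (lam * mu))); [known ..|].
by rewrite YE; pentagon.
Qed.

Lemma tetrahedron_interleaved lam mu nu :
  eqs q e [:: (d lam, X'); (g lam, X); (d (lam * mu), Y'); (g (lam * mu), Y);
              (d nu, Z'); (g nu, Z); (d mu, V'); (g mu, V)]
    [:: (d nu, Z'); (g nu, Z); (d mu, V'); (g mu, V);
        (d (lam * nu), U'); (g (lam * nu), U); (d lam, X'); (g lam, X)].
Proof.
apply: eqs_trans; first by apply: eqs_unshuffle; [list_pos | comm ..].
apply: eqs_trans; last first.
  by apply: eqs_sym; apply: eqs_unshuffle; [list_pos | comm ..].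
refine (@eqs_step _ _ _ [::] _ _ [:: (g lam, X); (g (lam * mu), Y); (g nu, Z); (g mu, V)]
  _ _ _ (tetrahedron_tilde lam mu nu) _); [list_pos | list_pos |].
refine (@eqs_step _ _ _ [:: (d nu, Z'); (d mu, V'); (d (lam * nu), U'); (d lam, X')] _ _ [::]
  _ _ _ (tetrahedron_plain lam mu nu) _); [list_pos | list_pos | by []].
Qed.
Lemma coef_normalized l : f l = scale_coef (f l 0%N) (d l).
Proof. by apply: funext => n; rewrite /d /scale_coef mulrA f0 mul1r. Qed.

Lemma evs_normalized l1 l2 l3 l4 m1 m2 m3 m4 c1 c2 c3 c4 n1 n2 n3 n4 T :
  evs [:: (f l1, m1); (c1, n1); (f l2, m2); (c2, n2); (f l3, m3); (c3, n3); (f l4, m4); (c4, n4)] T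
  = f l1 0%N * f l2 0%N * f l3 0%N * f l4 0%N *
    evs [:: (d l1, m1); (c1, n1); (d l2, m2); (c2, n2); (d l3, m3); (c3, n3); (d l4, m4); (c4, n4)] T.
Proof.
transitivity (evs [:: (scale_coef (f l1 0%N) (d l1), m1); (c1, n1);
    (scale_coef (f l2 0%N) (d l2), m2); (c2, n2); (scale_coef (f l3 0%N) (d l3), m3); (c3, n3);
    (scale_coef (f l4 0%N) (d l4), m4); (c4, n4)] T); first by rewrite -!coef_normalized.
rewrite (@evs_scale K [::]) (@evs_scale K [:: _; _]) (@evs_scale K [:: _; _; _; _]).
by rewrite (@evs_scale K [:: _; _; _; _; _; _]) !mulrA.
Qed.

(** After normalization each side carries the product of its four constant terms; these products
    differ only in the values at [lam * mu] and [lam * nu]. *)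
Lemma eqs_signed lam mu nu : f (lam * mu) 0%N = f (lam * nu) 0%N ->
  eqs q e [:: (f lam, X'); (g lam, X); (f (lam * mu), Y'); (g (lam * mu), Y);
              (f nu, Z'); (g nu, Z); (f mu, V'); (g mu, V)]
    [:: (f nu, Z'); (g nu, Z); (f mu, V'); (g mu, V);
        (f (lam * nu), U'); (g (lam * nu), U); (f lam, X'); (g lam, X)].
Proof.
move=> sgn T Tt; rewrite !evs_normalized tetrahedron_interleaved // sgn.
by congr (_ * _); ring.
Qed.

Lemma eq_rep (A : fexpr K) t t' (G : mono -> mono) : rep e A t G -> t = t' -> rep e A t' G.
Proof. by move=> rA <-. Qed.

Let h123 : hom F123. Proof. exact: cal_F_hom. Qed.
Let h145 : hom F145. Proof. exact: cal_F_hom. Qed.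
Let h246 : hom F246. Proof. exact: cal_F_hom. Qed.
Let h356 : hom F356. Proof. exact: cal_F_hom. Qed.
Let p123 : pres e F123. Proof. by apply: cal_F_pres; rewrite // !vec6E. Qed.
Let p145 : pres e F145. Proof. by apply: cal_F_pres; rewrite // !vec6E. Qed.
Let p246 : pres e F246. Proof. by apply: cal_F_pres; rewrite // !vec6E. Qed.
Let p356 : pres e F356. Proof. by apply: cal_F_pres; rewrite // !vec6E. Qed.

Lemma hom_comp G G' : hom G -> hom G' -> hom (G \o G').
Proof. by move=> h h' x y; rewrite /= h' h. Qed.

Lemma pres_comp G G' : pres e G -> pres e G' -> pres e (G \o G').
Proof. by move=> h h' x; rewrite /= h h'. Qed.

Let R123 l : rep e (Rmat q r s f ind1 ind2 ind3 l)
  [:: (f l, wtilde r s ind1 ind2 ind3); (g l, w r s ind1 ind2 ind3)] F123.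
Proof. exact: rep_Rmat p123 pX pX'. Qed.

Let R356 l : rep e (Rmat q r s f ind3 ind5 ind6 l)
  [:: (f l, wtilde r s ind3 ind5 ind6); (g l, w r s ind3 ind5 ind6)] F356.
Proof. exact: rep_Rmat p356 pZ pZ'. Qed.

Let R145 l : rep e (Rmat q r s f ind1 ind4 ind5 l)
  [:: (f l, wtilde r s ind1 ind4 ind5); (g l, w r s ind1 ind4 ind5)] F145.
Proof.
(* [Y] is the image of this monomial under a degree-preserving automorphism, so positivity transfers
   back. *)
apply: rep_Rmat p145 _ _; first by have := pY; rewrite /positive p123.
by have := pY'; rewrite /positive p123.
Qed.

Let R246 l : rep e (Rmat q r s f ind2 ind4 ind6 l)
  [:: (f l, wtilde r s ind2 ind4 ind6); (g l, w r s ind2 ind4 ind6)] F246.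
Proof.
apply: rep_Rmat p246 _ _; first by have := pV; rewrite /positive p356.
by have := pV'; rewrite /positive p356.
Qed.

Lemma tetrahedron lam mu nu : f (lam * mu) 0%N = f (lam * nu) 0%N ->
  feq q
    (fmul (fmul (fmul (Rmat q r s f ind1 ind2 ind3 lam)
                      (Rmat q r s f ind1 ind4 ind5 (lam * mu)))
                (Rmat q r s f ind2 ind4 ind6 nu))
          (Rmat q r s f ind3 ind5 ind6 mu))
    (fmul (fmul (fmul (Rmat q r s f ind3 ind5 ind6 nu)
                      (Rmat q r s f ind2 ind4 ind6 mu))
                (Rmat q r s f ind1 ind4 ind5 (lam * nu)))
          (Rmat q r s f ind1 ind2 ind3 lam)).
Proof.
move=> sgn.
have lhs := rep_mul (hom_comp (hom_comp h123 h145) h246) (pres_comp (pres_comp p123 p145) p246)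
  (rep_mul (hom_comp h123 h145) (pres_comp p123 p145)
    (rep_mul h123 p123 (R123 lam) (R145 (lam * mu))) (R246 nu)) (R356 mu).
have rhs := rep_mul (hom_comp (hom_comp h356 h246) h145) (pres_comp (pres_comp p356 p246) p145)
  (rep_mul (hom_comp h356 h246) (pres_comp p356 p246)
    (rep_mul h356 p356 (R356 nu) (R246 mu)) (R145 (lam * nu))) (R123 lam).
(* Both sides must end in the same outer automorphism before their series can be compared. *)
rewrite -[_ \o F123]cal_F_tetrahedron in rhs.
refine (feq_rep q0 (eq_rep lhs _) (eq_rep rhs _) (eqs_signed sgn)).
  congr [:: _; _; _; _; (_, _); (_, _); (_, _); (_, _)].
  - exact: F123_F145_wtilde246.
  - exact: F123_F145_w246.
  - exact: F123_F145_F246_wtilde356.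
  exact: F123_F145_F246_w356.
congr [:: _; _; _; _; _; _; (_, _); (_, _)].
  exact: F356_F246_F145_wtilde123.
exact: F356_F246_F145_w123.
Qed.
End Tetrahedron.

(** * Specialization to complex q *)

Lemma expr_exprz_neq1 (R : realType) (q : R[i]) (z : int) (n : nat) :
  `|q| != 1 -> z != 0 -> (q ^ z) ^+ n.+1 != 1.
Proof.
move=> q1 z0; have norm_exprz : `|q ^ z| = `|q| ^ z.
  by case: z {z0} => k; rewrite ?NegzE -?exprnN ?normfV normrX.
apply/eqP => /(congr1 Num.norm) /eqP.
by rewrite normr1 normrX norm_exprz pexprn_eq1 ?exprz_ge0 //= pexprz_eq1 // (negbTE z0) (negbTE q1).
Qed.

Theorem corollary2 (R : realType) (q : R[i]) (hq0 : q != 0) (hq1 : `|q| != 1)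
  (r s : int) (hr : r != -1)
  (f : R[i] -> nat -> R[i]) (hf : forall l : R[i], fps_invertible (f l))
  (i j k : 'I_6) (hij : (i < j)%N) (hjk : (j < k)%N)
  (hinv : forall l : R[i],
     feq q (fmul (Rmat q r s f i j k l) (Rmat q r s f i j k l)) (fone R[i]))
  (lam mu nu : R[i]) (hsign : f (lam * mu) 0%N = f (lam * nu) 0%N) :
  feq q
    (fmul (fmul (fmul (Rmat q r s f ind1 ind2 ind3 lam)
                      (Rmat q r s f ind1 ind4 ind5 (lam * mu)))
                (Rmat q r s f ind2 ind4 ind6 nu))
          (Rmat q r s f ind3 ind5 ind6 mu))
    (fmul (fmul (fmul (Rmat q r s f ind3 ind5 ind6 nu)
                      (Rmat q r s f ind2 ind4 ind6 mu))
                (Rmat q r s f ind1 ind4 ind5 (lam * nu)))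
          (Rmat q r s f ind1 ind2 ind3 lam)).
Proof.
have ij : i != j by rewrite -val_eqE /= ltn_eqF.
have ik : i != k by rewrite -val_eqE /= ltn_eqF // (ltn_trans hij).
have jk : j != k by rewrite -val_eqE /= ltn_eqF.
(* The resulting facts concern only the coefficients of [f l] and no longer the indices, so the
   involution for one triple serves all four R's. *)
have hl l := Rmat_involution hq0 ij ik jk hr (erefl (f l)) erefl (hinv l).
apply: tetrahedron hq0 _ (fun l => (hl l).1) (fun l => (hl l).2) lam mu nu hsign => n.
by apply: expr_exprz_neq1; rewrite // addr_eq0.
Qed.
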